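(* Fix an o-minimal structure on the ordered field of real numbers $\mathbb{R}$; ``definable'' means definable in this structure. Let $K$ be a finite simplicial complex of $\mathbb{R}^n$, $L$ a finite simplicial complex of $\mathbb{R}^m$ and $f:|K|\to|L|$ a surjective continuous definable map. Then, for each $\varepsilon>0$, there exist two integers $\kappa,\ell\geq 0$ and a surjective simplicial map $h:|\mathrm{sd}^{\kappa}(K)|=|K|\to|\mathrm{sd}^{\ell}(L)|=|L|$ (simplicial with respect to the complexes $\mathrm{sd}^{\kappa}(K)$ and $\mathrm{sd}^{\ell}(L)$) such that $\|f-h\|<\varepsilon$.
   Context: An o-minimal structure on the ordered field $\mathbb{R}$ is a collection $\mathfrak{S}=\{\mathfrak{S}_n\}_{n\geq 1}$, where $\mathfrak{S}_n$ is a family of subsets of $\mathbb{R}^n$, such that: each $\mathfrak{S}_n$ is a Boolean algebra (of subsets of $\mathbb{R}^n$); $\mathfrak{S}_n$ contains all algebraic subsets of $\mathbb{R}^n$; if $X\in\mathfrak{S}_n$ and $Y\in\mathfrak{S}_m$ then $X\times Y\in\mathfrak{S}_{n+m}$; if $\pi:\mathbb{R}^n\times\mathbb{R}\to\mathbb{R}^n$ is the projection and $X\in\mathfrak{S}_{n+1}$ then $\pi(X)\in\mathfrak{S}_n$; $\mathfrak{S}_1$ consists exactly of all finite unions of points and intervals of any type. Elements of $\mathfrak{S}_n$ are the definable subsets of $\mathbb{R}^n$. A map between definable sets is definable if its graph is definable. Simplices are closed: a simplex of dimension $d$ in $\mathbb{R}^n$ is the convex hull of $d+1$ affinely independent points.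 A finite simplicial complex $K$ of $\mathbb{R}^n$ is a finite family of simplices of $\mathbb{R}^n$ closed under taking faces and such that any two simplices of $K$ are either disjoint or meet in a common face. Its polyhedron is $|K|:=\bigcup_{\sigma\in K}\sigma$ with the Euclidean topology. $\mathrm{sd}^{\kappa}(K)$ denotes the $\kappa$-th barycentric subdivision of $K$, with $\mathrm{sd}^0(K)=K$. A map $h:|K|\to|L|$ is simplicial (with respect to $K$ and $L$) if its restriction to each simplex of $K$ is the restriction of an affine map $\mathbb{R}^n\to\mathbb{R}^m$ and, whenever vertices $\nu_0,\ldots,\nu_k$ of $K$ span a simplex of $K$, the points $h(\nu_0),\ldots,h(\nu_k)$ are vertices of $L$ that span a simplex of $L$ (repetitions among the images are allowed). For a continuous map $f:X\to\mathbb{R}^m$ on a compact set $X$, $\|f\|:=\max_{x\in X}|f(x)|_m$, where $|\cdot|_m$ is the Euclidean norm. *)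

(* Defs.v *)
From HB Require Import structures.
From mathcomp Require Import all_boot all_order all_algebra finmap.
From mathcomp Require Import all_classical all_reals all_analysis.
(* Not imported: the notations of mpoly clash with those of mathcomp-analysis. *)
From mathcomp Require mpoly.

Set Implicit Arguments.
Unset Strict Implicit.
Unset Printing Implicit Defensive.

Import Order.TTheory GRing.Theory Num.Theory.
Import numFieldNormedType.Exports.

Local Open Scope classical_set_scope.
Local Open Scope ring_scope.

(* R^n is 'rV[R]_n. Its library topology is the Euclidean one, but its library
   norm is the sup norm, whence [enorm]. *)
Definition enorm (R : realType) (n : nat) (x : 'rV[R]_n) : R :=
  Num.sqrt (\sum_(i < n) x 0 i ^+ 2).

(* For a continuous g on a compact nonempty X this supremum is a maximum;
   [sup set0 = 0]. *)
Definition fun_norm (R : realType) (n m : nat) (X : set 'rV[R]_n)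
    (g : 'rV[R]_n -> 'rV[R]_m) : R :=
  sup [set enorm (g x) | x in X].

Definition algebraic_set (R : realType) (n : nat) (X : set 'rV[R]_n) : Prop :=
  exists P : set (mpoly.mpoly n R),
    X = [set x : 'rV[R]_n |
          forall p, P p -> mpoly.meval (fun i => x 0 i) p = 0].

(* Points are the intervals `[a, a]. *)
Definition finite_union_of_intervals (R : realType) (X : set 'rV[R]_1) : Prop :=
  exists s : seq (interval R),
    X = [set x : 'rV[R]_1 | exists2 I, I \in s & x 0 0 \in I].

(* The family is indexed by n >= 1: nothing is required of [definable 0]. *)
Record o_minimal_structure (R : realType) := OMinimalStructure {
  definable : forall n : nat, set (set 'rV[R]_n);
  definable_set0 : forall n, (0 < n)%N -> definable (@set0 'rV[R]_n);
  definable_setC : forall n (X : set 'rV[R]_n), (0 < n)%N ->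
    definable X -> definable (~` X);
  definable_setU : forall n (X Y : set 'rV[R]_n), (0 < n)%N ->
    definable X -> definable Y -> definable (X `|` Y);
  definable_algebraic : forall n (X : set 'rV[R]_n), (0 < n)%N ->
    algebraic_set X -> definable X;
  definable_setX : forall n m (X : set 'rV[R]_n) (Y : set 'rV[R]_m),
    (0 < n)%N -> (0 < m)%N -> definable X -> definable Y ->
    definable [set z : 'rV[R]_(n + m) | X (lsubmx z) /\ Y (rsubmx z)];
  definable_proj : forall n (X : set 'rV[R]_(n + 1)), (0 < n)%N ->
    definable X -> definable [set lsubmx z | z in X];
  definable1 : forall X : set 'rV[R]_1,
    definable X <-> finite_union_of_intervals X
}.

Definition definable_map (R : realType) (S : o_minimal_structure R) (n m : nat)
    (X : set 'rV[R]_n) (f : 'rV[R]_n -> 'rV[R]_m) : Prop :=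
  definable S [set z : 'rV[R]_(n + m) | X (lsubmx z) /\ rsubmx z = f (lsubmx z)].

Definition affinely_independent (R : realType) (n : nat)
    (s : {fset 'rV[R]_n}) : Prop :=
  forall w : 'rV[R]_n -> R,
    \sum_(v <- s) w v = 0 -> \sum_(v <- s) w v *: v = 0 ->
    forall v, v \in s -> w v = 0.

Definition hull (R : realType) (n : nat) (s : {fset 'rV[R]_n}) :
    set 'rV[R]_n :=
  [set x | exists w : 'rV[R]_n -> R,
    [/\ forall v, v \in s -> 0 <= w v,
        \sum_(v <- s) w v = 1 &
        x = \sum_(v <- s) w v *: v]].

(* A simplex is encoded by its vertex set s, and is then the point set [hull s];
   its faces are the nonempty subsets of s. *)
Definition simplicial_complex (R : realType) (n : nat)
    (K : {fset {fset 'rV[R]_n}}) : Prop :=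
  [/\ forall s, s \in K -> s != fset0 /\ affinely_independent s,
      forall s t : {fset 'rV[R]_n},
        s \in K -> t != fset0 -> (t `<=` s)%fset -> t \in K &
      forall s t : {fset 'rV[R]_n}, s \in K -> t \in K ->
        hull s `&` hull t = set0 \/
        exists u : {fset 'rV[R]_n},
          [/\ u != fset0, (u `<=` s)%fset, (u `<=` t)%fset &
              hull s `&` hull t = hull u]].

Definition polyhedron (R : realType) (n : nat) (K : {fset {fset 'rV[R]_n}}) :
    set 'rV[R]_n :=
  [set x | exists2 s, s \in K & hull s x].

Definition barycenter (R : realType) (n : nat) (s : {fset 'rV[R]_n}) :
    'rV[R]_n :=
  (#|` s|%:R)^-1 *: \sum_(v <- s) v.

(* The simplices of the barycentric subdivision are spanned by the barycenters
   of the members of the nonempty flags s_0 < ... < s_k of simplices of K. *)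
Definition sd (R : realType) (n : nat) (K : {fset {fset 'rV[R]_n}}) :
    {fset {fset 'rV[R]_n}} :=
  [fset [fset barycenter s | s in (C : {fset {fset 'rV[R]_n}})]%fset
    | C in fpowerset K
    & (C != fset0) && all2rel (fun s t => (s `<=` t) || (t `<=` s))%fset C]%fset.

Definition iter_sd (R : realType) (n : nat) (k : nat)
    (K : {fset {fset 'rV[R]_n}}) : {fset {fset 'rV[R]_n}} :=
  iter k (@sd R n) K.

(* Maps |K| -> |L| are total functions of which only the restriction to the
   polyhedron of K matters. *)
Definition simplicial_map (R : realType) (n m : nat)
    (K : {fset {fset 'rV[R]_n}}) (L : {fset {fset 'rV[R]_m}})
    (h : 'rV[R]_n -> 'rV[R]_m) : Prop :=
  [/\ set_fun (polyhedron K) (polyhedron L) h,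
      forall s, s \in K ->
        exists (A : 'M[R]_(n, m)) (b : 'rV[R]_m),
          forall x, hull s x -> h x = x *m A + b &
      forall s : {fset 'rV[R]_n}, s \in K -> [fset h v | v in s]%fset \in L].

(* Main.v *)
Require Import Defs.
From mathcomp Require Import all_boot all_order all_algebra finmap.
From mathcomp Require Import all_classical all_reals all_analysis.
From mathcomp Require Import ring lra zify.
From mathcomp Require mpoly.
(* Only the canonical instances: the notations of mpoly clash with those of
   mathcomp-analysis. *)
Import (canonicals) mpoly.
Import Order.TTheory GRing.Theory Num.Theory.
Import numFieldNormedType.Exports.
Local Open Scope classical_set_scope.
Local Open Scope ring_scope.

Set Implicit Arguments.
Unset Strict Implicit.
Unset Printing Implicit Defensive.

(* Let L' be a fine subdivision of L. A definable map does not raise dimension,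
   so for every maximal simplex t of L' the open set f^-1(int t) meets a simplex
   of K of dimension at least dim t. A fine subdivision K' of K therefore has a
   simplex s_t with dim s_t >= dim t such that f maps the closed stars of all its
   vertices into int t. Label every vertex v of K' by a vertex of L' whose open
   star contains the image of the closed star of v; on the vertices of s_t every
   vertex of t is allowed, so the labels can be chosen to exhaust t. The induced
   simplicial map is close to f, and it maps s_t onto t, hence is surjective.

   For the dimension inequality, write a subset of R^(e+d) behind a word of
   quantifiers "for some x_i" and "for infinitely many x_i". Two adjacent
   quantifiers can be exchanged without losing a quantifier "for infinitely
   many"; when both are infinite this holds because an infinite definable subset
   of R contains an interval with rational endpoints, is uncountable, and there
   are only countably many such intervals. If e < d, moving the d infinite
   quantifiers over the values behind the e quantifiers over the arguments leaves
   an infinite one on the values: some argument has infinitely many values. *)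

(** * Definable sets *)

Section Definability.
Context {R : realType} (S : o_minimal_structure R).

Lemma definable_setI N (X Y : set 'rV[R]_N) : (0 < N)%N ->
  definable S X -> definable S Y -> definable S (X `&` Y).
Proof.
move=> N0 dX dY; rewrite -[X `&` Y]setCK setCI.
by apply: definable_setC => //; apply: definable_setU => //; apply: definable_setC.
Qed.

Lemma definable_bigcup N (I : eqType) (r : seq I) (F : I -> set 'rV[R]_N) :
  (0 < N)%N -> (forall i, i \in r -> definable S (F i)) ->
  definable S [set x | exists2 i, i \in r & F i x].
Proof.
move=> N0; elim: r => [|i r IH] dF.
  rewrite (_ : [set x | _] = set0); first exact: definable_set0.
  by apply/seteqP; split=> // x [].
rewrite (_ : [set x | _] = F i `|` [set x | exists2 i, i \in r & F i x]).
  apply: definable_setU => //; first by apply: dF; rewrite mem_head.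
  by apply: IH => j jr; apply: dF; rewrite in_cons jr orbT.
apply/seteqP; split=> x /=.
  move=> [j]; rewrite in_cons => /predU1P[->|jr] Fx; [by left|right].
  by exists j.
move=> [Fx|[j jr Fx]]; first by exists i => //; rewrite mem_head.
by exists j => //; rewrite in_cons jr orbT.
Qed.

(** [definable_proj] drops one coordinate at a time, hence the induction on [k]. The dimension is a
    variable [N] tied to [M + k] by an equation, which avoids casts between matrix types. *)
Lemma definable_restrict M k N (e : N = (M + k)%N) (le : (M <= N)%N)
    (X : set 'rV[R]_N) : (0 < M)%N ->
  definable S X -> definable S [set colsub (widen_ord le) z | z in X].
Proof.
move=> M0; elim: k N e le X => [|k IH] N e le X dX.
  rewrite addn0 in e; subst N.
  rewrite (_ : [set _ | _ in _] = X) //.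
  have E z : colsub (widen_ord le) z = z :> 'rV[R]_M.
    by apply/rowP => i; rewrite mxE; congr (z _ _); apply/val_inj.
  by apply/seteqP; split=> [_ [z Xz <-]|z Xz]; rewrite ?E //; exists z => //; rewrite E.
rewrite addnS -addn1 in e; subst N.
have lek : (M <= M + k)%N by rewrite leq_addr.
have := IH _ erefl lek _ (definable_proj (ltn_addr k M0) dX).
congr (definable S _); rewrite image_comp; apply: eq_imagel => z _ /=.
by apply/rowP => i; rewrite !mxE; congr (z _ _); apply/val_inj.
Qed.

Lemma definable_lsubmx M N (X : set 'rV[R]_(M + N)) : (0 < M)%N ->
  definable S X -> definable S [set lsubmx z | z in X].
Proof.
move=> M0 dX; have := definable_restrict erefl (leq_addr N M) M0 dX.
congr (definable S _); apply: eq_imagel => z _.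
by apply/rowP => i; rewrite !mxE; congr (z _ _); apply/val_inj.
Qed.

Lemma definable_setT N : (0 < N)%N -> definable S [set: 'rV[R]_N].
Proof. by move=> N0; rewrite -setC0; apply/definable_setC/definable_set0. Qed.

Lemma definable_poly N (I : Type) (p : I -> mpoly.mpoly N R) : (0 < N)%N ->
  definable S [set x : 'rV[R]_N |
    forall i, mpoly.meval (fun j => x 0 j) (p i) = 0].
Proof.
move=> N0; apply: definable_algebraic => //.
exists (range p); apply/seteqP; split=> [x px _ [i _ <-]//|x px i].
by apply: px; exists i.
Qed.

Local Notation "'X_ i" := (mpoly.mpolyX R (mpoly.mnm1 i)).

(** The preimage is the projection of the graph of the affine map, an algebraic set, cut with the
    cylinder over [X]. *)
Lemma definable_affine_preimage N M (A : 'M[R]_(M, N)) (b : 'rV_N)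
    (X : set 'rV[R]_N) : (0 < N)%N -> (0 < M)%N ->
  definable S X -> definable S [set x : 'rV_M | X (x *m A + b)].
Proof.
move=> N0 M0 dX.
pose p (j : 'I_N) : mpoly.mpoly (M + N) R :=
  'X_(rshift M j) - (\sum_(i < M) A i j *: 'X_(lshift N i) + mpoly.mpolyC (M + N) (b 0 j)).
pose W := [set z : 'rV[R]_(M + N) | [set: 'rV_M] (lsubmx z) /\ X (rsubmx z)] `&`
  [set z | forall j, mpoly.meval (fun k => z 0 k) (p j) = 0].
have dW : definable S W.
  have MN0 : (0 < M + N)%N by rewrite addn_gt0 M0.
  apply: definable_setI => //; last exact: definable_poly.
  by apply: definable_setX => //; apply: definable_setT.
have := definable_lsubmx M0 dW; congr (definable S _).
have pE (z : 'rV[R]_(M + N)) j : mpoly.meval (fun k => z 0 k) (p j) =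
    rsubmx z 0 j - (lsubmx z *m A + b) 0 j.
  rewrite /p mpoly.mevalB mpoly.mevalD mpoly.mevalC mpoly.mevalXU !mxE raddf_sum /=.
  congr (_ - (_ + _)); apply: eq_bigr => i _.
  by rewrite mpoly.mevalZ mpoly.mevalXU mxE mulrC.
apply/seteqP; split=> [_ [z [[_ Xz] Ez] <-]|x Xx] /=.
  suff -> : lsubmx z *m A + b = rsubmx z by [].
  by apply/rowP => j; apply/eqP; rewrite eq_sym -subr_eq0 -pE Ez.
exists (row_mx x (x *m A + b)); last by rewrite row_mxKl.
split; first by rewrite /= row_mxKr.
by move=> j; rewrite pE row_mxKl row_mxKr subrr.
Qed.

(** As [s] may repeat or omit coordinates, this covers permutations, diagonals and cylinders. *)
Lemma definable_colsub N M (s : 'I_N -> 'I_M) (X : set 'rV[R]_N) :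
  (0 < N)%N -> (0 < M)%N ->
  definable S X -> definable S [set x : 'rV_M | X (colsub s x)].
Proof.
move=> N0 M0 dX.
have := definable_affine_preimage (\matrix_(i, j) (i == s j)%:R) 0 N0 M0 dX.
congr (definable S _); apply/seteqP.
suff E x : x *m (\matrix_(i, j) (i == s j)%:R) + 0 = colsub s x :> 'rV[R]_N.
  by split=> x /=; rewrite E.
apply/rowP => j; rewrite addr0 !mxE (bigD1 (s j)) //= mxE eqxx mulr1 big1 ?addr0 //.
by move=> i /negPf ne; rewrite mxE ne mulr0.
Qed.

(** The order is a projection of an algebraic set: a real number is positive iff its product with
    some square is 1. *)
Lemma definable_lt M (i j : 'I_M) : (0 < M)%N ->
  definable S [set x : 'rV[R]_M | x 0 i < x 0 j].
Proof.
move=> M0; pose t : 'I_(M + 1) := rshift M ord0.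
pose p (_ : unit) : mpoly.mpoly (M + 1) R :=
  ('X_(lshift 1 j) - 'X_(lshift 1 i)) * ('X_t * 'X_t) - mpoly.mpolyC _ 1.
have := definable_lsubmx M0 (definable_poly p (ltn_addr 1 M0)).
congr (definable S _).
have pE (z : 'rV[R]_(M + 1)) : mpoly.meval (fun k => z 0 k) (p tt) =
    (lsubmx z 0 j - lsubmx z 0 i) * rsubmx z 0 0 ^+ 2 - 1.
  by rewrite /p mpoly.mevalB mpoly.mevalC !mpoly.mevalM mpoly.mevalB !mpoly.mevalXU !mxE.
apply/seteqP; split=> [_ [z /(_ tt) pz <-]|x /= ij].
  move: pz; rewrite pE /= => /eqP; rewrite subr_eq0 => /eqP E.
  rewrite -subr_gt0 ltNge; apply/negP => le0.
  have := mulr_le0_ge0 le0 (sqr_ge0 (rsubmx z 0 0)).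
  by rewrite E ler10.
exists (row_mx x (const_mx (Num.sqrt (x 0 j - x 0 i)^-1))); last by rewrite row_mxKl.
move=> [] /=; rewrite pE row_mxKl row_mxKr mxE sqr_sqrtr ?invr_ge0 ?subr_ge0 ?ltW //.
by rewrite divff ?subrr // subr_eq0 gt_eqF.
Qed.

End Definability.

(** * Quantifiers and dimension *)

Section Quantifiers.
Context {R : realType} {N : nat}.
Implicit Types (X : set 'rV[R]_N) (x : 'rV[R]_N) (i j : 'I_N).

Definition upd x i (t : R) : 'rV[R]_N := \row_j (if j == i then t else x 0 j).

Lemma updE x i t j : upd x i t 0 j = if j == i then t else x 0 j.
Proof. by rewrite mxE. Qed.

Lemma upd_comm x i j s t : i != j ->
  upd (upd x i s) j t = upd (upd x j t) i s.
Proof.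
move=> ij; apply/rowP => k; rewrite !updE.
by case: (eqVneq k i) => // ->; rewrite (negPf ij).
Qed.

(* The cylindrical quantifiers over the i-th coordinate: "for some value"
   ([b = false]) and "for infinitely many values" ([b = true]). *)
Definition quant (b : bool) i X : set 'rV[R]_N :=
  [set x | if b then infinite_set [set t | X (upd x i t)]
           else exists t, X (upd x i t)].

Lemma quant_setU b i X Y x : quant b i (X `|` Y) x -> quant b i X x \/ quant b i Y x.
Proof.
case: b => /= [H|[t [Xt|Yt]]]; [|by left; exists t|by right; exists t].
apply: contrapT => /not_orP[/contrapT fX /contrapT fY]; apply: H.
rewrite (_ : [set t | _] = [set t | X (upd x i t)] `|` [set t | Y (upd x i t)]) //.
by rewrite finite_setU.
Qed.

Lemma quant_sub b i X Y : X `<=` Y -> quant b i X `<=` quant b i Y.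
Proof.
move=> XY x; case: b => /= [|[t /XY]]; last by exists t.
by apply: sub_infinite_set => t /XY.
Qed.

(** The head of the word is the outermost quantifier. *)
Definition quants (w : seq ('I_N * bool)) X := foldr (fun p => quant p.2 p.1) X w.

Lemma quants_cat w1 w2 X : quants (w1 ++ w2) X = quants w1 (quants w2 X).
Proof. by rewrite /quants foldr_cat. Qed.

Lemma quants_setU w X Y x : quants w (X `|` Y) x -> quants w X x \/ quants w Y x.
Proof.
elim: w x => [//|[i b] w IH] x /= Q; apply: quant_setU.
by apply: quant_sub Q; apply: IH.
Qed.

Lemma quants_sub w X Y : X `<=` Y -> quants w X `<=` quants w Y.
Proof. by move=> XY; elim: w => [//|[i b] w IH] /=; apply: quant_sub. Qed.

End Quantifiers.

(** * Exchange of quantifiers and the dimension inequality *)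

Section Dimension.
Context {R : realType} (S : o_minimal_structure R).

(** A countable set has Lebesgue measure zero, while the interval has measure [v - u]. *)
Lemma uncountable_itvoo (u v : R) : u < v -> ~ countable `]u, v[.
Proof.
move=> uv cuv; have := countable_lebesgue_measure0 cuv; rewrite lebesgue_measure_itv /= lte_fin uv.
by rewrite -EFinB => /eqP; rewrite eqe subr_eq0 gt_eqF.
Qed.

(** One of the intervals must be infinite; it contains two distinct points and everything between
    them. *)
Lemma infinite_fin_union (s : seq (interval R)) :
  infinite_set [set t : R | exists2 I, I \in s & t \in I] ->
  exists u v : R, u < v /\ forall t, u < t < v -> exists2 I, I \in s & t \in I.
Proof.
elim: s => [H|I s IH].
  by case: H; rewrite (_ : [set t | _] = set0) //; apply/seteqP; split=> // t [].
have [fI|iI _] := pselect (finite_set [set` I]).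
  move=> H; have /IH [u [v [uv uvs]]] :
      infinite_set [set t : R | exists2 J, J \in s & t \in J].
    move=> fs; apply: H; apply: sub_finite_set (_ : finite_set ([set` I] `|` _)).
      move=> t /= [J]; rewrite in_cons => /predU1P[->|Js] tJ; [by left|right].
      exact: (ex_intro2 _ _ J Js tJ).
    by rewrite finite_setU; split.
  exists u, v; split=> // t /uvs [J Js tJ]; exists J => //.
  by rewrite in_cons Js orbT.
have [u [v [uv uI vI]]] : exists u v : R, [/\ u < v, u \in I & v \in I].
  have [u uI] := infinite_setN0 iI.
  have [v [vI /eqP]] := infinite_setN0 (infinite_setD iI (finite_set1 u)).
  by rewrite neq_lt => /orP[lt|lt]; [exists v, u|exists u, v].
exists u, v; split=> // t /andP[ut tv]; exists I; first exact: mem_head.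
by apply: (interval_is_interval uI vI); rewrite !ltW.
Qed.

(** O-minimality enters here, through [definable1]: the fibre is a finite union of intervals. The
    equivalence expresses the quantifier for infinitely many values by means of the order. *)
Lemma infinite_fiber N (X : set 'rV[R]_N) (x : 'rV[R]_N) (i : 'I_N) :
  definable S X ->
  infinite_set [set t | X (upd x i t)] <->
  exists u v : R, u < v /\ forall t, u < t < v -> X (upd x i t).
Proof.
move=> dX; have N0 : (0 < N)%N by apply: leq_ltn_trans (ltn_ord i).
split=> [|[u [v [uv uvX]]]]; last first.
  apply: contra_not (uncountable_itvoo uv) => fX.
  apply/finite_set_countable/sub_finite_set/fX => t /=.
  by rewrite in_itv /=; apply: uvX.
have [s sE] : finite_union_of_intervals [set y : 'rV[R]_1 | X (upd x i (y 0 0))].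
  apply/(definable1 S); have := definable_affine_preimage (delta_mx 0 i) (upd x i 0) N0 (ltn0Sn 0) dX.
  congr (definable S _); apply/seteqP.
  suff E (y : 'rV[R]_1) : y *m delta_mx 0 i + upd x i 0 = upd x i (y 0 0) by split=> y /=; rewrite E.
  apply/rowP => j; rewrite !mxE big_ord1 !mxE !ord1 /=.
  by case: eqVneq => _; rewrite ?mulr1 ?addr0 // mulr0 add0r.
have E t : X (upd x i t) <-> exists2 I, I \in s & t \in I.
  have /seteqP[sub sup] := sE.
  have := sub (const_mx t); have := sup (const_mx t); rewrite /= !mxE.
  by move=> ? ?; split.
rewrite (_ : [set t | _] = [set t : R | exists2 I, I \in s & t \in I]); last first.
  by apply/seteqP; split=> t /= /E.
move=> /infinite_fin_union [u [v [uv uvs]]]; exists u, v; split=> // t /uvs.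
by move/E.
Qed.

Lemma definable_ex N (X : set 'rV[R]_N) (i : 'I_N) :
  definable S X -> definable S (quant false i X).
Proof.
move=> dX; have N0 : (0 < N)%N by apply: leq_ltn_trans (ltn_ord i).
(* The new value of the i-th coordinate is stored in an extra last coordinate, which the projection
   then removes. *)
pose s (j : 'I_N) : 'I_(N + 1) := if j == i then rshift N ord0 else lshift 1 j.
have := definable_lsubmx N0 (definable_colsub s N0 (ltn_addr 1 N0) dX).
congr (definable S _).
have E z : colsub s z = upd (lsubmx z) i (rsubmx z 0 0).
  by apply/rowP => j; rewrite /s !mxE; case: ifP => // _; rewrite ?mxE.
apply/seteqP; split=> [_ [z Xz <-]|x [t Xt]] /=.
  by exists (rsubmx z 0 0); rewrite -E.
exists (row_mx x (const_mx t)); last by rewrite row_mxKl.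
by rewrite /= E row_mxKl row_mxKr mxE.
Qed.

(** By [infinite_fiber], two extra coordinates can hold the endpoints of an interval inside the
    fibre; that all of the interval lies there is the negation of an existential quantifier. *)
Lemma definable_inf N (X : set 'rV[R]_N) (i : 'I_N) :
  definable S X -> definable S (quant true i X).
Proof.
move=> dX; have N0 : (0 < N)%N by apply: leq_ltn_trans (ltn_ord i).
pose sh (j : 'I_N) : 'I_(N + 2) := lshift 2 j.
pose a : 'I_(N + 2) := rshift N ord0; pose b : 'I_(N + 2) := rshift N ord_max.
have N20 := ltn_addr 2 N0.
pose W := [set z : 'rV[R]_(N + 2) | z 0 a < z 0 b] `&`
  ~` quant false (sh i) ([set z : 'rV[R]_(N + 2) | z 0 a < z 0 (sh i)] `&`
     [set z | z 0 (sh i) < z 0 b] `&` ~` [set z | X (colsub sh z)]).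
have dW : definable S W.
  apply: definable_setI => //; first exact: definable_lt.
  apply: definable_setC => //; apply: definable_ex; apply: definable_setI => //.
    by apply: definable_setI => //; apply: definable_lt.
  by apply: definable_setC => //; apply: definable_colsub.
have E (z : 'rV[R]_(N + 2)) t : colsub sh (upd z (sh i) t) = upd (lsubmx z) i t.
  by apply/rowP => j; rewrite !mxE (inj_eq (@lshift_inj _ _)).
have := definable_lsubmx N0 dW; congr (definable S _).
apply/seteqP; split=> [_ [z [ab H] <-]|x /(infinite_fiber _ _ dX) [u [v [uv uvX]]]] /=.
  apply/(infinite_fiber _ _ dX); exists (z 0 a), (z 0 b); split=> // t atb.
  rewrite -E; apply: contrapT => nX; apply: H; exists t; split=> //=.
  by rewrite !updE eqxx !eq_rlshift; apply/andP.
exists (row_mx x (row_mx (const_mx u : 'rV[R]_1) (const_mx v : 'rV[R]_1))); last by rewrite row_mxKl.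
have ea (z : 'rV[R]_2) : row_mx x z 0 a = z 0 ord0 by rewrite row_mxEr.
have eb (z : 'rV[R]_2) : row_mx x z 0 b = z 0 ord_max by rewrite row_mxEr.
have e0 : row_mx (const_mx u : 'rV[R]_1) (const_mx v : 'rV[R]_1) 0 ord0 = u.
  by rewrite mxE; case: splitP => // k _; rewrite mxE.
have e1 : row_mx (const_mx u : 'rV[R]_1) (const_mx v : 'rV[R]_1) 0 ord_max = v.
  by rewrite mxE; case: splitP => k; rewrite ?mxE // => e; have := ltn_ord k; rewrite -e.
split; first by rewrite /= ea eb e0 e1.
move=> [t [[]]] /=; rewrite !updE eqxx !eq_rlshift E /= row_mxKl ea eb e0 e1.
by move=> ut tv; apply; apply: uvX; rewrite ut.
Qed.

Lemma definable_quants N (w : seq ('I_N * bool)) (X : set 'rV[R]_N) :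
  definable S X -> definable S (quants w X).
Proof.
move=> dX; elim: w => [//|[i []] w IH] /=; [exact: definable_inf|exact: definable_ex].
Qed.

(* If infinitely many fibres [Z_s] are infinite, uncountably many of them
   contain the same interval with rational endpoints. *)
Lemma quant_inf_comm N (i j : 'I_N) (X : set 'rV[R]_N) : i != j -> definable S X ->
  quant true i (quant true j X) `<=` quant true j (quant true i X).
Proof.
move=> ij dX x /(infinite_fiber _ _ (definable_inf j dX)) [u [v [uv uvX]]].
pose D (q : rat * rat) := [set s | forall t, ratr q.1 < t < ratr q.2 -> X (upd (upd x i s) j t)].
have [q [q12 Dq]] : exists q : rat * rat, q.1 < q.2 /\ infinite_set (D q).
  apply: contrapT => nq; apply: (uncountable_itvoo uv).
  apply: (@sub_countable _ _ _ (\bigcup_(q in [set q : rat * rat | q.1 < q.2]) D q)); last first.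
    apply: bigcup_countable => // q q12; apply: finite_set_countable.
    by apply: contrapT => iD; apply: nq; exists q.
  apply: subset_card_le => s /=; rewrite in_itv /= => /uvX.
  move=> /(infinite_fiber _ _ dX) [a [b [ab abX]]].
  have [p] := rat_in_itvoo ab; rewrite in_itv /= => /andP[ap pb].
  have [r] := rat_in_itvoo pb; rewrite in_itv /= => /andP[pr rb].
  exists (p, r) => /=; first by rewrite ltr_rat in pr.
  by move=> t /= /andP[pt tr]; apply: abX; rewrite (lt_trans ap pt) (lt_trans tr rb).
apply/(infinite_fiber _ _ (definable_inf i dX)).
exists (ratr q.1), (ratr q.2); split; first by rewrite ltr_rat.
move=> t tq; apply: sub_infinite_set Dq => s /(_ t tq).
by rewrite upd_comm.
Qed.

Lemma quant_ex_comm N (b : bool) (i j : 'I_N) (X : set 'rV[R]_N) : i != j ->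
  quant false i (quant b j X) `<=` quant b j (quant false i X).
Proof.
move=> ij x [s]; case: b => /=; last first.
  by move=> [t Xt]; exists t, s; rewrite upd_comm // eq_sym.
by apply: sub_infinite_set => t Xt; exists s; rewrite upd_comm // eq_sym.
Qed.

(** A pigeonhole argument: if only finitely many values of the j-th coordinate occur, each for
    finitely many values of the i-th, then only finitely many values of the i-th occur at all. *)
Lemma quant_inf_ex_comm N (i j : 'I_N) (X : set 'rV[R]_N) : i != j ->
  quant true i (quant false j X) `<=`
  quant false j (quant true i X) `|` quant true j (quant false i X).
Proof.
move=> ij x H; apply: contrapT => /not_orP[nE /contrapT fI]; apply: H.
apply: (@sub_finite_set _ _ (\bigcup_(t in [set t | quant false i X (upd x j t)])
  [set s | X (upd (upd x j t) i s)])).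
  move=> s /= [t]; rewrite upd_comm // => Xst; exists t => //=.
  by exists s.
apply: bigcup_finite => // t _; apply: contrapT => iF; apply: nE.
by exists t.
Qed.

Definition ninf N (w : seq ('I_N * bool)) := count snd w.

(** There are two alternatives because exchanging an infinite quantifier with an existential one
    gives a disjunction; the other cases repeat one alternative. Neither loses an infinite
    quantifier. *)
Lemma quant_swap N (b c : bool) (i j : 'I_N) (X : set 'rV[R]_N) : i != j ->
  definable S X -> exists b1 c1 b2 c2 : bool,
  [/\ (b + c <= b1 + c1)%N, (b + c <= b2 + c2)%N &
  quant b i (quant c j X) `<=`
  quant c1 j (quant b1 i X) `|` quant c2 j (quant b2 i X)].
Proof.
move=> ij dX; case: b.
  case: c; last first.
    exists true, false, false, true; split=> //; exact: quant_inf_ex_comm.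
  exists true, true, true, true; split=> //.
  by apply: subset_trans (@subsetUl _ _ _); apply: quant_inf_comm.
exists false, c, false, c; split=> //.
by apply: subset_trans (@subsetUl _ _ _); apply: quant_ex_comm.
Qed.

(** A swap yields only one of two words, so the word is quantified away; the order of the variables
    and a lower bound on the number of infinite quantifiers are kept. *)
Definition at_least N k (v : seq 'I_N) (X : set 'rV[R]_N) : set 'rV[R]_N :=
  [set x | exists w, [/\ unzip1 w = v, (k <= ninf w)%N & quants w X x]].

Lemma at_least_swap N k (v1 v2 : seq 'I_N) i j (X : set 'rV[R]_N) : i != j ->
  definable S X ->
  at_least k (v1 ++ i :: j :: v2) X `<=` at_least k (v1 ++ j :: i :: v2) X.
Proof.
move=> ij dX x [w [wE kw Qw]].
have [w1 [b [c [w2 [wE' w1E w2E]]]]] : exists w1 b c w2,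
    [/\ w = w1 ++ (i, b) :: (j, c) :: w2, unzip1 w1 = v1 & unzip1 w2 = v2].
  elim: v1 w wE {kw Qw} => [|l v1 IH] [//|[l' b] w] /=.
    case: w => [//|[j' c] w] /= [-> -> <-].
    by exists [::], b, c, w.
  move=> [-> /IH [w1 [b' [c [w2 [-> <- <-]]]]]].
  by exists ((l, b) :: w1), b', c, w2.
subst w; rewrite quants_cat /= in Qw.
have [b1 [c1 [b2 [c2 [le1 le2 sub]]]]] :=
  quant_swap b c ij (definable_quants w2 dX).
have main (b' c' : bool) : (b + c <= b' + c')%N ->
    quants w1 (quant c' j (quant b' i (quants w2 X))) x ->
    at_least k (v1 ++ j :: i :: v2) X x.
  move=> le Q; exists (w1 ++ (j, c') :: (i, b') :: w2); split.
  - by rewrite /unzip1 map_cat /= -/(unzip1 _) -/(unzip1 _) w1E w2E.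
  - apply: leq_trans kw _; rewrite /ninf !count_cat /= leq_add2l !addnA leq_add2r.
    by rewrite (addnC c').
  - by rewrite quants_cat.
(* The outer word [w1] distributes over the union of the two alternatives. *)
by case: (quants_setU (quants_sub sub Qw)); apply: main.
Qed.

Lemma at_least_move N k (v1 v2 v3 : seq 'I_N) i (X : set 'rV[R]_N) : i \notin v2 ->
  definable S X ->
  at_least k (v1 ++ v2 ++ i :: v3) X `<=` at_least k (v1 ++ i :: v2 ++ v3) X.
Proof.
move=> iv dX; elim/last_ind: v2 v3 iv => [|v2 j IH] v3; first by move=> _ x.
rewrite mem_rcons in_cons negb_or => /andP[ij iv] x.
rewrite cat_rcons catA => /at_least_swap; rewrite eq_sym => /(_ ij dX).
by rewrite -catA => /(IH _ iv); rewrite cat_rcons.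
Qed.

Lemma at_least_catC N k (v1 v2 v3 : seq 'I_N) (X : set 'rV[R]_N) :
  ~~ has (mem v2) v3 -> definable S X ->
  at_least k (v1 ++ v2 ++ v3) X `<=` at_least k (v1 ++ v3 ++ v2) X.
Proof.
move=> nv dX; elim: v3 v1 nv => [|i v3 IH] v1 /=; first by rewrite cats0 => _ x.
rewrite negb_or => /andP[iv nv] x /(at_least_move iv dX); rewrite -!cat_rcons.
exact: IH.
Qed.

Lemma quants_ex N (w : seq ('I_N * bool)) (X : set 'rV[R]_N) x : quants w X x ->
  exists2 y, X y & forall i, i \notin unzip1 w -> y 0 i = x 0 i.
Proof.
elim: w x => [|[i b] w IH] x /=; first by exists x.
move=> Q; have [t /IH [y Xy E]] : exists t, quants w X (upd x i t).
  by case: b Q => //= /infinite_setN0.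
by exists y => // j; rewrite in_cons negb_or => /andP[/negPf ji /E]; rewrite updE ji.
Qed.

(** An infinite quantifier would give infinitely many values of its coordinate, each attained at a
    point of the finite set. *)
Lemma quants_finite N (w : seq ('I_N * bool)) (X : set 'rV[R]_N) x :
  uniq (unzip1 w) -> quants w X x ->
  finite_set [set y | X y /\ forall i, i \notin unzip1 w -> y 0 i = x 0 i] ->
  ninf w = 0%N.
Proof.
elim: w x => [//|[i b] w IH] x /= /andP[iw uw] Q fX.
have sub t : [set y | X y /\ forall j, j \notin unzip1 w -> y 0 j = upd x i t 0 j] `<=`
    [set y | X y /\ forall j, j \notin i :: unzip1 w -> y 0 j = x 0 j].
  move=> y [Xy E]; split=> // j; rewrite in_cons negb_or => /andP[/negPf ji /E].
  by rewrite updE ji.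
have [t Qt] : exists t, quants w X (upd x i t).
  by case: b Q => //= /infinite_setN0.
have -> := IH _ uw Qt (sub_finite_set (sub t) fX); rewrite addn0.
case: b Q => //= Q; case: Q; apply: sub_finite_set (finite_image (fun y : 'rV[R]_N => y 0 i) fX).
move=> s /quants_ex [y Xy E]; exists y; last by rewrite E // updE eqxx.
by split=> // j; rewrite in_cons negb_or => /andP[/negPf ji /E]; rewrite updE ji.
Qed.

(** Read contrapositively: a definable set with finite fibres over R^e cannot project onto an open
    box of R^d when [e < d]. *)
Lemma finite_fibers_dim e d (X : set 'rV[R]_(e + d)) (a b : R) : (e < d)%N ->
  definable S X -> a < b ->
  (forall y : 'rV[R]_d, (forall j, a < y 0 j < b) -> exists x : 'rV[R]_e, X (row_mx x y)) ->
  exists x : 'rV[R]_e, infinite_set [set y : 'rV[R]_d | X (row_mx x y)].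
Proof.
move=> ed dX ab H; apply: contrapT => nX.
pose va := [seq lshift d i | i : 'I_e]; pose vb := [seq rshift e j | j : 'I_d].
have unz c (v : seq 'I_(e + d)) : [seq p.1 | p <- [seq (j, c) | j <- v]] = v.
  by elim: v => //= j v ->.
have cnt (v : seq 'I_(e + d)) : count snd [seq (j, true) | j <- v] = size v.
  by elim: v => //= j v ->.
have sva : size va = e by rewrite size_image card_ord.
have svb : size vb = d by rewrite size_image card_ord.
(* Induction on the variables still to be quantified: those of R^e outside [v] already carry the
   coordinates of the witness [y]. *)
have Ha v (x : 'rV_(e + d)) y : X (row_mx y (rsubmx x)) ->
    (forall i, lshift d i \notin v -> x 0 (lshift d i) = y 0 i) ->
    quants [seq (i, false) | i <- v] X x.
  elim: v x => [|i0 v IH] x /= Xy Hy.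
    suff -> : x = row_mx y (rsubmx x) by [].
    by rewrite -{1}[x]hsubmxK; congr row_mx; apply/rowP => i; rewrite mxE Hy.
  case: (split_ordP i0) => i i0E; last first.
    exists (x 0 i0); rewrite (_ : upd _ _ _ = x).
      by apply: IH => // k kv; apply: Hy; rewrite in_cons negb_or kv i0E eq_lrshift.
    by apply/rowP => k; rewrite updE; case: eqVneq => // ->.
  exists (y 0 i); apply: IH.
    by rewrite (_ : rsubmx _ = rsubmx x) //; apply/rowP => k; rewrite !mxE i0E eq_rlshift.
  move=> k kv; rewrite updE i0E (inj_eq (@lshift_inj _ _)); case: eqVneq => [->//|ki].
  by apply: Hy; rewrite in_cons negb_or kv i0E (inj_eq (@lshift_inj _ _)) ki.
(* For the outer block, variables outside [v] already lie in the box, and each further one may take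
   any of the uncountably many values between [a] and [b]. *)
have Hb v (x : 'rV_(e + d)) :
    (forall j, rshift e j \notin v -> a < x 0 (rshift e j) < b) ->
    quants [seq (j, true) | j <- v] (quants [seq (i, false) | i <- va] X) x.
  elim: v x => [|j0 v IH] x /= Hx.
    have [y Xy] : exists y, X (row_mx y (rsubmx x)).
      by apply: H => j; rewrite mxE; apply: Hx.
    by apply: Ha Xy _ => i; rewrite fintype.image_f.
  move=> fi; apply: (uncountable_itvoo ab); apply: finite_set_countable.
  apply: sub_finite_set fi => t /=; rewrite in_itv /= => tab; apply: IH => j jv.
  by rewrite updE; case: eqVneq => // ne; apply: Hx; rewrite in_cons negb_or ne.
have /(at_least_catC (v1 := [::])) /= : at_least d (vb ++ va) X 0.
  exists ([seq (j, true) | j <- vb] ++ [seq (i, false) | i <- va]); split.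
  - by rewrite /unzip1 map_cat; congr (_ ++ _); apply: unz.
  - by rewrite /ninf count_cat cnt svb leq_addr.
  rewrite quants_cat.
  by apply: Hb => j; rewrite fintype.image_f.
have nab : ~~ has (mem vb) va.
  by apply/hasP => -[_ /mapP[i _ ->] /mapP[j _ /eqP]]; rewrite eq_lrshift.
move=> /(_ nab dX) [w [wE dw Qw]].
have [w1 [w2 [wE' w1E w2E]]] : exists w1 w2, [/\ w = w1 ++ w2, unzip1 w1 = va & unzip1 w2 = vb].
  exists (take (size va) w), (drop (size va) w); rewrite cat_take_drop; split=> //.
    by rewrite /unzip1 map_take -/(unzip1 _) wE take_size_cat.
  by rewrite /unzip1 map_drop -/(unzip1 _) wE drop_size_cat.
subst w; rewrite quants_cat in Qw.
(* The point [x] fixes the values chosen along [w1]; the remaining word [w2] runs over [vb] only. *)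
have [x Qx _] := quants_ex Qw.
have uvb : uniq vb by rewrite map_inj_uniq ?enum_uniq //; apply: rshift_inj.
have /(quants_finite (x := x)) : uniq (unzip1 w2) by rewrite w2E.
(* All of the at least [d] infinite quantifiers would sit in [w1], a word of length [e]. *)
move=> /(_ _ Qx) n0; suff : (d <= e)%N by rewrite leqNgt ed.
apply: leq_trans dw _; rewrite /ninf count_cat -!/(ninf _) n0 ?addn0.
  by apply: leq_trans (count_size _ _) _; rewrite -(size_map fst) -/(unzip1 _) w1E sva.
rewrite w2E; apply: contrapT => iX; apply: nX; exists (lsubmx x) => fX; apply: iX.
apply: sub_finite_set (finite_image (fun y : 'rV[R]_d => row_mx (lsubmx x) y) fX).
move=> y [Xy E]; exists (rsubmx y).
  rewrite /= (_ : lsubmx x = lsubmx y) ?hsubmxK //.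
  apply/rowP => i; rewrite !mxE E //.
  by apply/negP => /mapP[j _ /eqP]; rewrite eq_lrshift.
rewrite -[RHS]hsubmxK; congr row_mx.
apply/rowP => i; rewrite !mxE E //.
by apply/negP => /mapP[j _ /eqP]; rewrite eq_lrshift.
Qed.

End Dimension.

(** * Simplices and their hulls *)

Section SeqExtremum.
Context {T : eqType}.

Lemma seq_argmax (s : seq T) (f : T -> nat) : s != [::] ->
  exists2 x, x \in s & forall y, y \in s -> (f y <= f x)%N.
Proof.
elim: s => [//|a s IH] _; have [->|/IH [x xs xmax]] := eqVneq s [::].
  by exists a; rewrite ?mem_head // => y; rewrite inE => /eqP ->.
have [ax|xa] := leqP (f a) (f x).
  exists x; rewrite ?in_cons ?xs ?orbT // => y; rewrite in_cons => /predU1P[->//|].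
  exact: xmax.
exists a; rewrite ?mem_head // => y; rewrite in_cons => /predU1P[->//|/xmax yx].
exact: leq_trans yx (ltnW xa).
Qed.

Lemma seq_argmin {R : realDomainType} (s : seq T) (f : T -> R) : s != [::] ->
  exists2 x, x \in s & forall y, y \in s -> f x <= f y.
Proof.
elim: s => [//|a s IH] _; have [->|/IH [x xs xmin]] := eqVneq s [::].
  by exists a; rewrite ?mem_head // => y; rewrite inE => /eqP ->.
have [xa|ax] := leP (f x) (f a).
  exists x; rewrite ?in_cons ?xs ?orbT // => y; rewrite in_cons => /predU1P[->//|].
  exact: xmin.
exists a; rewrite ?mem_head // => y; rewrite in_cons => /predU1P[->//|/xmin yx].
exact: le_trans (ltW ax) yx.
Qed.

End SeqExtremum.

Lemma fset_seq_neq0 {T : choiceType} (s : {fset T}) : s != fset0 -> enum_fset s != [::].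
Proof.
move=> /fset0Pn[x xs]; apply/eqP => e.
by have : x \in enum_fset s by []; rewrite e.
Qed.

Section Hulls.
Context {R : realType} {n : nat}.
Local Notation V := 'rV[R]_n.
Implicit Types (s t : {fset V}) (x y : V).

(* The relative interior of [hull s]. *)
Definition ohull s : set V :=
  [set x | exists w : V -> R,
    [/\ forall v, v \in s -> 0 < w v,
        \sum_(v <- s) w v = 1 & x = \sum_(v <- s) w v *: v]].

Lemma sum_extend (M : nmodType) (T : choiceType) (s t : {fset T}) (F : T -> M) :
  (s `<=` t)%fset ->
  \sum_(v <- t) (if v \in s then F v else 0) = \sum_(v <- s) F v.
Proof.
move=> st; rewrite -(big_fset_incl _ st) //; last by move=> v _ /negPf ->.
by apply: eq_big_seq => v ->.
Qed.

Lemma ohull_hull s : ohull s `<=` hull s.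
Proof. by move=> x [w [w0 w1 ->]]; exists w; split=> // v /w0/ltW. Qed.

Lemma hull_sub s t : (s `<=` t)%fset -> hull s `<=` hull t.
Proof.
move=> st x [w [w0 w1 ->]]; exists (fun v => if v \in s then w v else 0); split.
- by move=> v _; case: ifP => // /w0.
- by rewrite sum_extend.
- rewrite -(sum_extend (t := t)) //; apply: eq_bigr => v _.
  by case: ifP => //; rewrite scale0r.
Qed.

Lemma hull_vertex s v : v \in s -> hull s v.
Proof.
move=> vs; apply: (@hull_sub [fset v]%fset); first by rewrite fsub1set.
exists (fun=> 1); split=> //; rewrite big_seq_fset1 //.
by rewrite scale1r.
Qed.

(** The face is spanned by the vertices of positive weight. *)
Lemma hull_ohull s x : hull s x ->
  exists t, [/\ t != fset0, (t `<=` s)%fset & ohull t x].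
Proof.
move=> [w [w0 w1 ->]]; pose t := [fset v in s | 0 < w v]%fset.
have ts : (t `<=` s)%fset by apply/fsubsetP => v; rewrite !inE => /andP[].
have wt0 v : v \in s -> v \notin t -> w v = 0.
  move=> vs; rewrite !inE vs /= -leNgt => w0'.
  by apply/eqP; rewrite eq_le w0' w0.
have t1 : \sum_(v <- t) w v = 1 by rewrite (big_fset_incl _ ts).
exists t; split=> //.
  apply/eqP => t0; move: t1; rewrite t0 big_seq_fset0 => /eqP.
  by rewrite eq_sym oner_eq0.
exists w; split=> //; first by move=> v; rewrite !inE => /andP[].
by rewrite (big_fset_incl _ ts) // => v vs vt; rewrite wt0 // scale0r.
Qed.

Lemma affinely_independent_inj s (w w' : V -> R) : affinely_independent s ->
  \sum_(v <- s) w v = \sum_(v <- s) w' v ->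
  \sum_(v <- s) w v *: v = \sum_(v <- s) w' v *: v ->
  forall v, v \in s -> w v = w' v.
Proof.
move=> ind e1 e2 v vs; apply/eqP; rewrite -subr_eq0; apply/eqP.
apply: (ind (fun v => w v - w' v)) vs; rewrite ?big_split /= ?sumrN ?e1 ?subrr //.
by under eq_bigr do rewrite scalerBl; rewrite big_split /= sumrN e2 subrr.
Qed.

(** By uniqueness of barycentric coordinates, a vertex of [s] outside [u] would have weight zero,
    but its weight is positive. *)
Lemma ohull_hull_sub s u x : affinely_independent s -> (u `<=` s)%fset ->
  ohull s x -> hull u x -> u = s.
Proof.
move=> ind us [w [w0 w1 ->]] [w' [_ w'1 e]]; apply/eqP; rewrite eqEfsubset us.
apply/fsubsetP => v vs; apply: contraLR (w0 _ vs) => vu.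
rewrite (affinely_independent_inj (w' := fun v => if v \in u then w' v else 0) ind _ _ vs).
- by rewrite (negPf vu) ltxx.
- by rewrite sum_extend // w1.
- rewrite e -(sum_extend (t := s)) //; apply: eq_bigr => y _.
  by case: ifP => //; rewrite scale0r.
Qed.

Lemma hull_conv (I : eqType) (r : seq I) (l : I -> R) (F : I -> V) s :
  (forall i, i \in r -> 0 <= l i) -> \sum_(i <- r) l i = 1 ->
  (forall i, i \in r -> hull s (F i)) -> hull s (\sum_(i <- r) l i *: F i).
Proof.
move=> l0 l1 hF.
have [W HW] : {W : I -> V -> R & forall i, i \in r -> [/\ forall v, v \in s -> 0 <= W i v,
    \sum_(v <- s) W i v = 1 & F i = \sum_(v <- s) W i v *: v]}.
  apply: (@choice _ _ (fun i w => i \in r -> [/\ forall v, v \in s -> 0 <= w v,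
    \sum_(v <- s) w v = 1 & F i = \sum_(v <- s) w v *: v])) => i.
  by have [/hF[w ?]|?] := boolP (i \in r); [exists w|exists (fun=> 0)].
exists (fun v => \sum_(i <- r) l i * W i v); split.
- move=> v vs; rewrite big_seq; apply: sumr_ge0 => i ir.
  by apply: mulr_ge0; rewrite ?l0 //; have [-> //] := HW i ir.
- rewrite exchange_big /= -l1; apply: eq_big_seq => i ir.
  by rewrite -mulr_sumr; have [_ -> _] := HW i ir; rewrite mulr1.
- under [RHS]eq_bigr do rewrite scaler_suml.
  rewrite exchange_big /=; apply: eq_big_seq => i ir.
  have [_ _ ->] := HW i ir; rewrite scaler_sumr; apply: eq_bigr => v _.
  by rewrite scalerA.
Qed.

Lemma barycenterE s : barycenter s = \sum_(v <- s) (#|` s|%:R)^-1 *: v.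
Proof. by rewrite /barycenter scaler_sumr. Qed.

Lemma fset_sum1 (T : choiceType) (s : {fset T}) : s != fset0 ->
  \sum_(v <- s) (#|` s|%:R)^-1 = 1 :> R.
Proof.
move=> s0; rewrite big_const_seq count_predT iter_addr_0 -[LHS]mulr_natr.
by rewrite mulVf // pnatr_eq0 cardfs_eq0.
Qed.

Lemma barycenter_ohull s : s != fset0 -> ohull s (barycenter s).
Proof.
move=> s0; exists (fun=> (#|` s|%:R)^-1); split.
- by move=> v _; rewrite invr_gt0 ltr0n cardfs_gt0.
- exact: fset_sum1.
- exact: barycenterE.
Qed.

(** Lifting the points to height 1 in R^(n+1) turns affine independence into linear independence. *)
Definition lift_mx s : 'M[R]_(#|` s|, n + 1) := \matrix_(i < #|` s|) row_mx s`_i (1 : 'rV[R]_1).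

Lemma lift_mx_free s : affinely_independent s -> row_free (lift_mx s).
Proof.
move=> ind; apply/inj_row_free => u uM; apply/rowP => i; rewrite [RHS]mxE.
pose w v := if insub (index v s) is Some i then u 0 i else 0.
have wE (j : 'I_#|` s|) : w s`_j = u 0 j.
  rewrite /w index_uniq ?fset_uniq // insubT //= => p.
  by congr (u _ _); apply/val_inj.
have e : \sum_(v <- s) w v *: row_mx v (1 : 'rV[R]_1) = 0.
  rewrite (big_nth 0) big_mkord -[RHS]uM mulmx_sum_row.
  have E (j : 'I_#|` s|) : w s`_j *: row_mx s`_j (1 : 'rV[R]_1) = u 0 j *: row j (lift_mx s).
    by rewrite wE; congr (_ *: _); apply/rowP => k; rewrite !mxE.
  exact (eq_bigr _ (fun j _ => E j)).
rewrite -wE; apply: (ind w); last exact: mem_nth.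
  have := congr1 (fun z => rsubmx z 0 0) e; rewrite !raddf_sum /= summxE !mxE => e0.
  by rewrite -[RHS]e0; apply: eq_bigr => v _; rewrite linearZ /= row_mxKr !mxE mulr1.
have := congr1 lsubmx e; rewrite !raddf_sum /= raddf0 => e0.
by rewrite -[RHS]e0; apply: eq_bigr => v _; rewrite linearZ /= row_mxKl.
Qed.

Lemma card_affinely_independent s : affinely_independent s -> (#|` s| <= n.+1)%N.
Proof. by move=> /lift_mx_free /eqP <-; apply: leq_trans (rank_leq_col _) _; rewrite addn1. Qed.

(** The lifted vertex matrix has a right inverse; its product with the matrix of values is a linear
    map on R^(n+1), whose upper rows give the linear part and whose last row gives the
    translation. *)
Lemma affine_extension m s (g : V -> 'rV[R]_m) : affinely_independent s ->
  exists (A : 'M[R]_(n, m)) (b : 'rV[R]_m), forall v, v \in s -> v *m A + b = g v.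
Proof.
move=> /lift_mx_free/row_freeP[B MB].
pose P := B *m \matrix_(i < #|` s|) g s`_i.
exists (usubmx P), (dsubmx P) => v vs.
have -> : v *m usubmx P + dsubmx P = row_mx v 1 *m P.
  by rewrite -[in RHS](vsubmxK P) mul_row_col mul1mx.
have iv : (index v s < #|` s|)%N by rewrite index_mem.
have -> : row_mx v 1 = row (Ordinal iv) (lift_mx s).
  by apply/rowP => k; rewrite !mxE /= nth_index.
by rewrite /P mulmxA -row_mul MB row1 -rowE rowK nth_index.
Qed.

Lemma affine_sum m (r : seq V) (w : V -> R) (A : 'M[R]_(n, m)) (b : 'rV[R]_m) :
  \sum_(v <- r) w v = 1 ->
  (\sum_(v <- r) w v *: v) *m A + b = \sum_(v <- r) w v *: (v *m A + b).
Proof.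
move=> w1; under [RHS]eq_bigr do rewrite scalerDr.
rewrite big_split /= -scaler_suml w1 scale1r mulmx_suml; congr (_ + _).
by apply: eq_bigr => v _; rewrite scalemxAl.
Qed.

End Hulls.

(** * Barycentric subdivision *)

Section Subdivision.
Context {R : realType} {n : nat}.
Local Notation V := 'rV[R]_n.
Implicit Types (s t : {fset V}) (x y : V) (K C : {fset {fset V}}).

(** The two hulls meet in a common face, which contains a point of the relative interior of [s] and
    is therefore [s] itself. *)
Lemma carrier_sub K s t x : simplicial_complex K -> s \in K -> t \in K ->
  ohull s x -> hull t x -> (s `<=` t)%fset.
Proof.
move=> [ind _ cap] sK tK sx tx.
case: (cap s t sK tK) => [e|[u [_ us ut e]]].
  have : set0 x by rewrite -e; split=> //; apply: ohull_hull.
  by [].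
have ux : hull u x by rewrite -e; split=> //; apply: ohull_hull.
by rewrite -(ohull_hull_sub (ind s sK).2 us sx ux).
Qed.

Lemma carrier_uniq K s t x : simplicial_complex K -> s \in K -> t \in K ->
  ohull s x -> ohull t x -> s = t.
Proof.
move=> cK sK tK sx tx; apply/eqP; rewrite eqEfsubset.
by rewrite (carrier_sub cK sK tK sx (ohull_hull tx)) (carrier_sub cK tK sK tx (ohull_hull sx)).
Qed.

Lemma carrier_ex K s x : simplicial_complex K -> s \in K -> hull s x ->
  exists t, [/\ t \in K, (t `<=` s)%fset & ohull t x].
Proof.
move=> [_ face _] sK /hull_ohull [t [t0 ts tx]].
by exists t; split=> //; apply: face ts.
Qed.

Definition chain C : bool :=
  all2rel (fun s t => (s `<=` t) || (t `<=` s))%fset C.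

Lemma chainP C : reflect (forall s t, s \in C -> t \in C ->
  (s `<=` t)%fset || (t `<=` s)%fset) (chain C).
Proof.
apply: (iffP allP) => [H s t sC tC|H s sC]; last by apply/allP => t tC; apply: H.
exact: (allP (H s sC) t tC).
Qed.

Lemma chain_sub C C' : (C `<=` C')%fset -> chain C' -> chain C.
Proof.
move=> /fsubsetP CC' /chainP cC; apply/chainP => s t /CC' sC /CC' tC.
exact: cC.
Qed.

Lemma in_sd K s : reflect
  (exists C, [/\ (C `<=` K)%fset, C != fset0, chain C &
     s = [fset barycenter t | t in C]%fset]) (s \in sd K).
Proof.
apply: (iffP idP) => [/imfsetP[C /=]|[C [CK C0 cC ->]]].
  by rewrite !inE fpowersetE => /and3P[CK C0 cC] ->; exists C.
by apply/imfsetP; exists C => //=; rewrite !inE fpowersetE CK C0.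
Qed.

(** Barycenters lie in the relative interiors of their simplices, and these are disjoint for
    distinct simplices. *)
Lemma barycenter_inj K : simplicial_complex K ->
  {in K &, injective (@barycenter R n)}.
Proof.
move=> cK s t sK tK e; have [ind _ _] := cK.
apply: (carrier_uniq cK sK tK (x := barycenter s)).
  by apply: barycenter_ohull; have [] := ind s sK.
by rewrite e; apply: barycenter_ohull; have [] := ind t tK.
Qed.

Lemma sum_barycenters (M : nmodType) K C (F : V -> M) :
  simplicial_complex K -> (C `<=` K)%fset ->
  \sum_(y <- [fset barycenter t | t in C]%fset) F y = \sum_(t <- C) F (barycenter t).
Proof.
move=> cK /fsubsetP CK; rewrite big_imfset // => s t sC tC.
by apply: (barycenter_inj cK); apply: CK.
Qed.

(* The weight of the vertex v in [\sum_(t <- C) l t *: barycenter t]. *)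
Definition vertex_weight C (l : {fset V} -> R) (v : V) : R :=
  \sum_(t <- C | v \in t) l t / #|` t|%:R.

(** The general [g] serves twice: the identity gives the point, the constant 1 its total weight. *)
Lemma sum_vertex_weight (M : lmodType R) C S (l : {fset V} -> R) (g : V -> M) :
  (forall t, t \in C -> (t `<=` S)%fset) ->
  \sum_(t <- C) l t *: ((#|` t|%:R)^-1 *: \sum_(v <- t) g v) =
  \sum_(v <- S) vertex_weight C l v *: g v.
Proof.
move=> CS; under [RHS]eq_bigr do rewrite /vertex_weight scaler_suml big_mkcond.
rewrite exchange_big /=; apply: eq_big_seq => t tC.
rewrite scalerA scaler_sumr -(sum_extend _ (CS t tC)).
by apply: eq_bigr.
Qed.

Lemma sum_vertex_weight1 C S (l : {fset V} -> R) :
  (forall t, t \in C -> (t `<=` S)%fset) -> (forall t, t \in C -> t != fset0) ->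
  \sum_(v <- S) vertex_weight C l v = \sum_(t <- C) l t.
Proof.
move=> CS C0; have := sum_vertex_weight l (fun=> 1 : R^o) CS.
under [X in _ = X -> _]eq_bigr do rewrite /GRing.scale /= mulr1.
move=> <-; apply: eq_big_seq => t tC.
rewrite scaler_sumr; under eq_bigr do rewrite /GRing.scale /= mulr1.
by rewrite fset_sum1 ?C0 // /GRing.scale /= mulr1.
Qed.

Lemma chain_max C : C != fset0 -> chain C ->
  exists2 S, S \in C & forall t, t \in C -> (t `<=` S)%fset.
Proof.
move=> /fset_seq_neq0 /(seq_argmax (fun s => #|` s|)) [S SC Smax] /chainP cC.
exists S => // t tC; have /orP[//|St] := cC t S tC SC.
by have /eqP -> : S == t by rewrite eqEfcard St Smax.
Qed.

(** Take a vertex of [t] outside the largest member of the chain strictly below [t], or any vertex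
    if [t] is the least member. *)
Lemma chain_fresh_vertex C t : chain C -> t \in C -> t != fset0 ->
  exists2 v, v \in t & forall t', t' \in C -> v \in t' -> (t `<=` t')%fset.
Proof.
move=> /chainP cC tC t0; pose D := [fset t' in C | (t' `<` t)%fset]%fset.
have [D0|D0] := eqVneq D fset0.
  have /fset0Pn[v vt] := t0; exists v => // t' t'C _.
  have /orP[//|t't] := cC t t' tC t'C; rewrite fsubEproper; apply/orP; left.
  apply: contraT => ne; have : t' \in D by rewrite !inE t'C fproperEneq eq_sym ne.
  by rewrite D0.
have [t0' t0D t0max] := seq_argmax (fun s => #|` s|) (fset_seq_neq0 D0).
have /andP[t0C t0t] : (t0' \in C) && (t0' `<` t)%fset by move: t0D; rewrite !inE.
have /fsubsetPn[v vt vt0] : ~~ (t `<=` t0')%fset by move: t0t; rewrite fproperE => /andP[].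
exists v => // t' t'C vt'; apply: contraT => ntt'.
have t't : (t' `<` t)%fset.
  by rewrite fproperE ntt' andbT; have := cC t t' tC t'C; rewrite (negPf ntt').
have t'D : t' \in D by rewrite !inE t'C.
have /orP[/fsubsetP sub|sub] := cC t' t0' t'C t0C.
  by rewrite (sub _ vt') in vt0.
have /eqP e : t0' == t' by rewrite eqEfcard sub t0max.
by rewrite e vt' in vt0.
Qed.

Lemma chain_barycenter_free K C (l : {fset V} -> R) : simplicial_complex K ->
  (C `<=` K)%fset -> chain C -> \sum_(t <- C) l t = 0 ->
  \sum_(t <- C) l t *: barycenter t = 0 -> forall t, t \in C -> l t = 0.
Proof.
move=> [ind _ _] /fsubsetP CK cC l1 lb t1 t1C; apply/eqP; apply: contraT => lt1.
pose D := [fset t in C | l t != 0]%fset.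
have D0 : D != fset0 by apply/fset0Pn; exists t1; rewrite !inE t1C.
have [t tD tmax] := seq_argmax (fun s => #|` s|) (fset_seq_neq0 D0).
have /andP[tC lt] : (t \in C) && (l t != 0) by move: tD; rewrite !inE.
have t0 : t != fset0 by have [] := ind t (CK t tC).
have C0 : C != fset0 by apply/fset0Pn; exists t.
have [S SC Smax] := chain_max C0 cC.
have [v vt vfresh] := chain_fresh_vertex cC tC t0.
have wv : vertex_weight C l v = 0.
  apply: ((ind S (CK S SC)).2 (vertex_weight C l)); last exact: (fsubsetP (Smax t tC)).
    by rewrite sum_vertex_weight1 // => t' /CK /ind[].
  by rewrite -sum_vertex_weight.
have : vertex_weight C l v = l t / #|` t|%:R.
  rewrite /vertex_weight big_mkcond (big_fsetD1 t) //= vt [X in _ + X]big1_fset ?addr0 //.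
  move=> t'; rewrite !inE => /andP[t't t'C] _; case: ifP => // /(vfresh t' t'C) tt'.
  have [->|lt'] := eqVneq (l t') 0; first by rewrite mul0r.
  have : (#|` t'| <= #|` t|)%N by apply: tmax; rewrite !inE t'C.
  by move=> le; move: t't; rewrite eq_sym eqEfcard tt' le.
move=> /eqP; rewrite wv eq_sym mulf_eq0 (negPf lt) invr_eq0 pnatr_eq0 cardfs_eq0.
by rewrite (negPf t0).
Qed.

Lemma chain_affinely_independent K C : simplicial_complex K ->
  (C `<=` K)%fset -> chain C ->
  affinely_independent [fset barycenter t | t in C]%fset.
Proof.
move=> cK CK cC w; rewrite !(sum_barycenters _ cK CK) => w0 wb v /imfsetP[t /= tC ->].
exact: (chain_barycenter_free (l := fun t => w (barycenter t)) cK CK cC w0 wb tC).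
Qed.

(* The members of a chain are strict superlevel sets of the vertex weights. *)
Lemma vertex_weight_level C (l : {fset V} -> R) s u v : chain C -> s \in C ->
  (forall t, t \in C -> 0 < l t) -> v \in s -> u \notin s ->
  vertex_weight C l u < vertex_weight C l v.
Proof.
move=> /chainP cC sC l0 vs us.
have lt0 t : t \in C -> 0 <= l t / #|` t|%:R.
  by move=> /l0/ltW ?; rewrite divr_ge0.
rewrite /vertex_weight big_mkcond [ltRHS]big_mkcond (big_fsetD1 s sC) [ltRHS](big_fsetD1 s sC) /=.
rewrite (negPf us) vs; apply: ltr_leD.
  rewrite divr_gt0 ?l0 // ltr0n cardfs_gt0.
  by apply/fset0Pn; exists v.
rewrite big_seq [leRHS]big_seq; apply: ler_sum => t; rewrite !inE => /andP[_ tC].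
case: ifP => ut; last by case: ifP => // _; apply: lt0.
have /orP[/fsubsetP st|/fsubsetP ts] := cC s t sC tC; first by rewrite st.
by rewrite (ts _ ut) in us.
Qed.

(** Vertices [v] in [s] but not [t] and [u] in [t] but not [s] would give [mu u < mu v < mu u]. *)
Lemma level_comparable (mu : V -> R) s t :
  (forall u v, v \in s -> u \notin s -> mu u < mu v) ->
  (forall u v, v \in t -> u \notin t -> mu u < mu v) ->
  (s `<=` t)%fset || (t `<=` s)%fset.
Proof.
move=> ls lt; have [//|/fsubsetPn[v vs vt]] := boolP (s `<=` t)%fset.
apply/fsubsetP => u ut; apply: contraT => us.
by have := lt_trans (ls _ _ vs us) (lt _ _ ut vt); rewrite ltxx.
Qed.

Lemma ohull_barycenters K C x : simplicial_complex K -> (C `<=` K)%fset ->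
  ohull [fset barycenter t | t in C]%fset x ->
  exists l : {fset V} -> R, [/\ forall t, t \in C -> 0 < l t,
    \sum_(t <- C) l t = 1 & x = \sum_(t <- C) l t *: barycenter t].
Proof.
move=> cK CK [w [w0 w1 ->]]; exists (fun t => w (barycenter t)).
rewrite !(sum_barycenters _ cK CK) in w1 *; split=> // t tC.
by apply: w0; apply/imfsetP; exists t.
Qed.

(** Locates an interior point of a flag simplex in [K]: its carrier is the largest member of the
    flag, and the vertex weights are its barycentric coordinates there. *)
Lemma chain_top K C (l : {fset V} -> R) : simplicial_complex K ->
  (C `<=` K)%fset -> chain C -> (forall t, t \in C -> 0 < l t) ->
  \sum_(t <- C) l t = 1 ->
  exists S, [/\ S \in C, forall t, t \in C -> (t `<=` S)%fset,
   forall v, v \in S -> 0 < vertex_weight C l v,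
   \sum_(v <- S) vertex_weight C l v = 1 &
   \sum_(t <- C) l t *: barycenter t = \sum_(v <- S) vertex_weight C l v *: v].
Proof.
move=> [ind _ _] /fsubsetP CK cC l0 l1.
have C0 : C != fset0.
  by apply/eqP => C0; move/eqP: l1; rewrite C0 big_seq_fset0 eq_sym oner_eq0.
have [S SC Smax] := chain_max C0 cC; exists S; split=> //.
- move=> v vS; rewrite /vertex_weight big_mkcond (big_fsetD1 S) //= vS.
  rewrite ltr_pwDl //; first by rewrite divr_gt0 ?l0 // ltr0n cardfs_gt0; have [] := ind S (CK S SC).
  rewrite big_seq; apply: sumr_ge0 => t; rewrite !inE => /andP[_ tC].
  by case: ifP => // _; rewrite divr_ge0 // ltW // l0.
- by rewrite sum_vertex_weight1 // => t /CK /ind[].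
- exact: sum_vertex_weight.
Qed.

(** Both flags have the same top simplex and the same vertex weights. Their members are superlevel
    sets of this one weight function, so the union of the flags is a chain; independence of its
    barycenters then makes the two families of coefficients, extended by zero, equal. *)
Lemma sd_carrier K C1 C2 x : simplicial_complex K ->
  (C1 `<=` K)%fset -> (C2 `<=` K)%fset -> chain C1 -> chain C2 ->
  ohull [fset barycenter t | t in C1]%fset x ->
  ohull [fset barycenter t | t in C2]%fset x -> (C1 `<=` C2)%fset.
Proof.
move=> cK C1K C2K c1 c2 /(ohull_barycenters cK C1K) [l1 [l10 l11 x1]].
move=> /(ohull_barycenters cK C2K) [l2 [l20 l21 x2]].
have [S [S1C S1max mu10 mu11 mu1x]] := chain_top cK C1K c1 l10 l11.
have [S2 [S2C S2max mu20 mu21 mu2x]] := chain_top cK C2K c2 l20 l21.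
have e : S = S2.
  apply: (carrier_uniq (x := x) cK (fsubsetP C1K _ S1C) (fsubsetP C2K _ S2C)).
    by exists (vertex_weight C1 l1); split=> //; rewrite -mu1x.
  by exists (vertex_weight C2 l2); split=> //; rewrite -mu2x.
subst S2.
have [ind _ _] := cK; have indS := (ind S (fsubsetP C1K _ S1C)).2.
have out C l v : (forall t, t \in C -> (t `<=` S)%fset) -> v \notin S ->
    vertex_weight C l v = 0.
  move=> CS vS; rewrite /vertex_weight big_seq_cond big1 // => t /andP[tC vt].
  by rewrite (fsubsetP (CS t tC) _ vt) in vS.
have mu12 v : vertex_weight C1 l1 v = vertex_weight C2 l2 v.
  have [vS|vS] := boolP (v \in S); last by rewrite !out.
  apply: (affinely_independent_inj indS); rewrite ?mu11 ?mu21 //.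
  by rewrite -mu1x -mu2x -x1 -x2.
pose C := (C1 `|` C2)%fset.
have lev s : s \in C -> forall u v, v \in s -> u \notin s ->
    vertex_weight C1 l1 u < vertex_weight C1 l1 v.
  rewrite inE => /orP[sC|sC] u v vs us; first by apply: (vertex_weight_level c1 sC l10 vs us).
  by rewrite !mu12; apply: (vertex_weight_level c2 sC l20 vs us).
have cC : chain C by apply/chainP => s t /lev ls /lev; apply: level_comparable.
have CK : (C `<=` K)%fset by rewrite fsubUset C1K.
pose ext C l (t : {fset V}) : R := if t \in C then l t else 0.
have ext1 C' l : (C' `<=` C)%fset -> \sum_(t <- C) ext C' l t = \sum_(t <- C') l t.
  exact: sum_extend.
have extb C' l : (C' `<=` C)%fset ->
    \sum_(t <- C) ext C' l t *: barycenter t = \sum_(t <- C') l t *: barycenter t.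
  move=> C'C; rewrite -(sum_extend _ C'C); apply: eq_bigr => t _.
  by rewrite /ext; case: ifP => //; rewrite scale0r.
apply/fsubsetP => s sC1; apply: contraT => sC2.
have := chain_barycenter_free (l := fun t => ext C1 l1 t - ext C2 l2 t) cK CK cC.
rewrite sumrB !ext1 ?fsubsetUl ?fsubsetUr // l11 l21 subrr => /(_ erefl).
under eq_bigr do rewrite scalerBl.
rewrite sumrB !extb ?fsubsetUl ?fsubsetUr // -x1 -x2 subrr => /(_ erefl s).
rewrite inE sC1 /ext sC1 (negPf sC2) subr0 => /(_ isT) e.
by have := l10 s sC1; rewrite e ltxx.
Qed.

Lemma sub_barycenters C t : (t `<=` [fset barycenter s | s in C])%fset ->
  exists2 C', (C' `<=` C)%fset & t = [fset barycenter s | s in C']%fset.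
Proof.
move=> /fsubsetP tC; exists [fset s in C | barycenter s \in t]%fset.
  by apply/fsubsetP => s; rewrite !inE => /andP[].
apply/fsetP => y; apply/idP/imfsetP => [yt|[s /=]].
  have /imfsetP[s /= sC e] := tC y yt; exists s => //.
  by rewrite !inE sC -e.
by rewrite !inE => /andP[_ st] ->.
Qed.

Lemma sd_complex K : simplicial_complex K -> simplicial_complex (sd K).
Proof.
move=> cK; have [ind face cap] := cK; split.
- move=> _ /in_sd[C [CK C0 cC ->]]; split; last exact: (chain_affinely_independent cK).
  by have /fset0Pn[s sC] := C0; apply/fset0Pn; exists (barycenter s); apply/imfsetP; exists s.
- move=> _ t /in_sd[C [CK C0 cC ->]] t0 /sub_barycenters[C' C'C tE].
  apply/in_sd; exists C'; split=> //; first exact: fsubset_trans CK.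
    by apply: contraNneq t0 => C'0; rewrite tE C'0 imfset0.
  exact: chain_sub cC.
- move=> _ _ /in_sd[C1 [C1K C10 c1 ->]] /in_sd[C2 [C2K C20 c2 ->]].
  pose C := (C1 `&` C2)%fset; pose u := [fset barycenter s | s in C]%fset.
  have u1 : (u `<=` [fset barycenter t | t in C1])%fset.
    by apply/subset_imfset => s /=; rewrite inE => /andP[].
  have u2 : (u `<=` [fset barycenter t | t in C2])%fset.
    by apply/subset_imfset => s /=; rewrite inE => /andP[].
  (* The carriers of a common point are spanned by subflags [D1] and [D2]; by [sd_carrier], [D1]
     lies in both flags. *)
  have main x : hull [fset barycenter t | t in C1]%fset x ->
      hull [fset barycenter t | t in C2]%fset x -> hull u x /\ u != fset0.
    move=> /hull_ohull[T1 [t10 /sub_barycenters[D1 D1C e1] x1]]; subst T1.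
    move=> /hull_ohull[T2 [_ /sub_barycenters[D2 D2C e2] x2]]; subst T2.
    have D12 : (D1 `<=` D2)%fset.
      apply: (sd_carrier cK _ _ _ _ x1 x2); do ?[exact: chain_sub c1|exact: chain_sub c2].
        exact: fsubset_trans C1K.
      exact: fsubset_trans C2K.
    have D1u : ([fset barycenter t | t in D1] `<=` u)%fset.
      apply/subset_imfset => s /= sD; rewrite inE (fsubsetP D1C) //=.
      by rewrite (fsubsetP D2C) // (fsubsetP D12).
    split; first by apply: hull_sub D1u _ (ohull_hull x1).
    exact: fsubset_neq0 D1u t10.
  have [u0|u0] := eqVneq u fset0.
    by left; apply/seteqP; split=> // x [x1 x2]; have [_] := main x x1 x2; rewrite u0 eqxx.
  right; exists u; split=> //; apply/seteqP; split=> [x [x1 x2]|x ux].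
    by have [] := main x x1 x2.
  by split; [apply: hull_sub u1 x ux|apply: hull_sub u2 x ux].
Qed.

End Subdivision.

(** * Full flags, polyhedra and meshes of subdivisions *)

Section SubdivisionMetric.
Context {R : realType} {n : nat}.
Local Notation V := 'rV[R]_n.
Implicit Types (s t : {fset V}) (x y : V) (K C : {fset {fset V}}).

(** Remove a vertex of least weight, subtract this weight from the others and recurse. Zero
    coefficients are allowed, so the flag has as many members as [s] has vertices. *)
Lemma full_flag s (mu : V -> R) : (forall v, v \in s -> 0 <= mu v) ->
  exists C (l : {fset V} -> R),
  [/\ forall t, t \in C -> (t `<=` s)%fset /\ t != fset0, chain C,
      #|` C| = #|` s|, forall t, t \in C -> 0 <= l t &
      \sum_(t <- C) l t = \sum_(v <- s) mu v /\
      \sum_(t <- C) l t *: barycenter t = \sum_(v <- s) mu v *: v].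
Proof.
move e : #|` s| => k; elim: k s mu e => [|k IH] s mu sk mu0.
  have -> : s = fset0 by apply: cardfs0_eq.
  exists fset0, (fun=> 0); split=> //; last by rewrite !big_seq_fset0.
have s0 : s != fset0 by rewrite -cardfs_gt0 sk.
have [v vs vmin] := seq_argmin mu (fset_seq_neq0 s0).
pose s' := (s `\ v)%fset; have s's : (s' `<=` s)%fset by apply: fsubD1set.
have s'k : #|` s'| = k by move: sk; rewrite (cardfsD1 v) vs => -[].
have [|C [l [Cs cC Ck l0 [l1 lx]]]] := IH s' (fun u => mu u - mu v) s'k.
  by move=> u us; rewrite subr_ge0 vmin // (fsubsetP s's).
have sC : s \notin C.
  apply/negP => /Cs[/fsubsetP/(_ v vs)]; by rewrite !inE eqxx.
(* Since [s] has [k.+1] vertices, this multiple of its barycenter puts weight [mu v] on each of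
   them. *)
pose l' t := if t == s then k.+1%:R * mu v else l t.
have l'C t : t \in C -> l' t = l t.
  by rewrite /l'; case: eqVneq => // ->; rewrite (negPf sC).
exists (s |` C)%fset, l'; split.
- move=> t; rewrite !inE => /predU1P[->//|/Cs[ts t0]]; split=> //.
  exact: fsubset_trans s's.
- apply/chainP => a b; rewrite !inE => /predU1P[->|aC] /predU1P[->|bC].
  + by rewrite fsubset_refl.
  + by rewrite (fsubset_trans _ s's) ?orbT //; have [] := Cs b bC.
  + by rewrite (fsubset_trans _ s's) //; have [] := Cs a aC.
  + by move/chainP: cC; apply.
- by rewrite cardfsU1 sC Ck.
- move=> t; rewrite !inE => /predU1P[->|tC]; last by rewrite l'C ?l0.
  by rewrite /l' eqxx mulr_ge0 // mu0.
have l's : l' s = k.+1%:R * mu v by rewrite /l' eqxx.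
split.
  rewrite big_fsetU1 //= l's (eq_big_seq l) // l1 (big_fsetD1 v vs) /= -/s'.
  rewrite sumrB big_const_seq count_predT iter_addr_0 -[size _]/(#|` s'|) s'k.
  by rewrite -[_ *+ k]mulr_natl -natr1; ring.
rewrite big_fsetU1 //= l's (eq_big_seq (fun t => l t *: barycenter t)); last first.
  by move=> t tC; rewrite l'C.
rewrite lx /barycenter sk scalerA mulrAC divff ?pnatr_eq0 // mul1r.
rewrite [in RHS](big_fsetD1 v vs) [in LHS](big_fsetD1 v vs) /= -/s'.
under [X in _ + X]eq_bigr do rewrite scalerBl.
by rewrite sumrB -scaler_sumr scalerDr -addrA [X in _ + X]addrC subrK.
Qed.

(** The count of vertices is what matters later: around any point of [s] there is a subdivided
    simplex of the same dimension. *)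
Lemma sd_flag K s x : simplicial_complex K -> s \in K -> hull s x ->
  exists s', [/\ s' \in sd K, hull s' x & #|` s'| = #|` s|].
Proof.
move=> cK sK [w [w0 w1 ->]]; have [ind face _] := cK.
have [C [l [Cs cC Ck l0 [l1 lx]]]] := full_flag w0.
have CK : (C `<=` K)%fset.
  by apply/fsubsetP => t /Cs[ts t0]; apply: face ts.
exists [fset barycenter t | t in C]%fset; split.
- apply/in_sd; exists C; split=> //.
  by rewrite -cardfs_gt0 Ck cardfs_gt0; have [] := ind s sK.
- rewrite -lx; apply: hull_conv; [exact: l0|by rewrite l1|].
  by move=> t tC; apply: hull_vertex; apply/imfsetP; exists t.
- rewrite -Ck; apply: card_in_imfset => t t' tC t'C.
  by apply: (barycenter_inj cK); apply: (fsubsetP CK).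
Qed.

Lemma polyhedron_sd K : simplicial_complex K -> polyhedron (sd K) = polyhedron K.
Proof.
move=> cK; apply/seteqP; split=> x [s sK sx]; last first.
  by have [s' [s'K s'x _]] := sd_flag cK sK sx; exists s'.
have /in_sd[C [CK C0 cC sE]] := sK.
have [S SC Smax] := chain_max C0 cC; exists S; first exact: (fsubsetP CK).
move: sx; rewrite sE => -[w [w0 w1 ->]].
apply: hull_conv => // _ /imfsetP[t /= tC ->].
apply: hull_sub (Smax t tC) _ _; apply/ohull_hull/barycenter_ohull.
by have [ind _ _] := cK; have [] := ind t (fsubsetP CK _ tC).
Qed.

Lemma iter_sd_complex K k : simplicial_complex K -> simplicial_complex (iter_sd k K).
Proof. by move=> cK; elim: k => //= k; apply: sd_complex. Qed.

Lemma polyhedron_iter_sd K k : simplicial_complex K ->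
  polyhedron (iter_sd k K) = polyhedron K.
Proof.
move=> cK; elim: k => //= k <-; apply: polyhedron_sd.
exact: iter_sd_complex.
Qed.

Lemma iter_sd_flag K k s x : simplicial_complex K -> s \in K -> hull s x ->
  exists s', [/\ s' \in iter_sd k K, hull s' x & #|` s'| = #|` s|].
Proof.
move=> cK sK sx; elim: k => [|k [s' [s'K s'x <-]]]; first by exists s.
exact: (sd_flag (iter_sd_complex k cK) s'K s'x).
Qed.

(** Distances are in the sup norm. Vertices suffice: the bound extends to any two points of a hull,
    by [mesh_hull]. *)
Definition mesh_le K (D : R) := forall s, s \in K ->
  forall u v, u \in s -> v \in s -> `|u - v| <= D.

Lemma norm_sub_avg s y (D : R) : s != fset0 ->
  (forall v, v \in s -> `|v - y| <= D) -> `|barycenter s - y| <= D.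
Proof.
move=> s0 vD; rewrite barycenterE.
have -> : y = \sum_(v <- s) (#|` s|%:R)^-1 *: y.
  by rewrite -scaler_suml fset_sum1 // scale1r.
rewrite -sumrB; under eq_bigr do rewrite -scalerBr.
apply: le_trans (ler_norm_sum _ _ _) _.
have -> : D = \sum_(v <- s) (#|` s|%:R)^-1 * D by rewrite -mulr_suml fset_sum1 // mul1r.
rewrite big_seq [leRHS]big_seq.
apply: ler_sum => v vs; rewrite normrZ ger0_norm ?invr_ge0 //.
by rewrite ler_wpM2l ?invr_ge0 // vD.
Qed.

(** In the average of the differences [u - v] the term of [v] itself vanishes, and (k-1)/k is at
    most n/(n+1) for k at most n+1. *)
Lemma norm_barycenter_sub s v (D : R) : v \in s -> (#|` s| <= n.+1)%N -> 0 <= D ->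
  (forall u, u \in s -> `|u - v| <= D) ->
  `|barycenter s - v| <= n%:R / n.+1%:R * D.
Proof.
move=> vs sn D0 uD; have s0 : s != fset0 by apply/fset0Pn; exists v.
rewrite barycenterE.
have {1}-> : v = \sum_(u <- s) (#|` s|%:R)^-1 *: v.
  by rewrite -scaler_suml fset_sum1 // scale1r.
rewrite -sumrB; under eq_bigr do rewrite -scalerBr.
rewrite (big_fsetD1 v vs) /= subrr scaler0 add0r.
apply: le_trans (ler_norm_sum _ _ _) _.
have cs : #|` s| = #|` (s `\ v)%fset|.+1 by rewrite (cardfsD1 v) vs.
apply: (@le_trans _ _ (\sum_(u <- (s `\ v)%fset) (#|` s|%:R)^-1 * D)).
  rewrite big_seq [leRHS]big_seq; apply: ler_sum => u; rewrite !inE => /andP[_ us].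
  by rewrite normrZ ger0_norm ?invr_ge0 // ler_wpM2l ?invr_ge0 // uD.
rewrite -mulr_suml ler_wpM2r // big_const_seq count_predT iter_addr_0.
rewrite cs -[leLHS]mulr_natl.
rewrite ler_pdivrMr ?ltr0n // mulrAC ler_pdivlMr ?ltr0n // -!natrM ler_nat.
rewrite cs ltnS in sn; lia.
Qed.

(** For nested [s] and [t], the barycenter of [s] averages vertices of [t], each of which is close
    to the barycenter of [t]. *)
Lemma sd_mesh K (D : R) : simplicial_complex K -> 0 <= D -> mesh_le K D ->
  mesh_le (sd K) (n%:R / n.+1%:R * D).
Proof.
move=> [ind _ _] D0 KD _ /in_sd[C [CK _ /chainP cC ->]] _ _ /imfsetP[s /= sC ->] /imfsetP[t /= tC ->].
wlog st : s t sC tC / (s `<=` t)%fset.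
  move=> H; have /orP[st|ts] := cC s t sC tC; first exact: H.
  by rewrite distrC; apply: H.
have sK := fsubsetP CK _ sC; have tK := fsubsetP CK _ tC.
apply: norm_sub_avg; first by have [] := ind s sK.
move=> v vs; have vt := fsubsetP st _ vs; rewrite distrC.
apply: norm_barycenter_sub => //; first by apply: card_affinely_independent; have [] := ind t tK.
by move=> u ut; apply: (KD t).
Qed.

Lemma mesh_ex K : exists2 D : R, 0 <= D & mesh_le K D.
Proof.
exists (\sum_(s <- K) \sum_(u <- s) \sum_(v <- s) `|u - v|).
  by do 3![apply: sumr_ge0 => ? _].
move=> s sK u v us vs; rewrite (big_fsetD1 s sK) (big_fsetD1 u us) (big_fsetD1 v vs) /=.
rewrite -!addrA lerDl; do ?[apply: addr_ge0].
- by apply: sumr_ge0.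
- by do 2![apply: sumr_ge0 => ? _].
- by do 3![apply: sumr_ge0 => ? _].
Qed.

Lemma iter_sd_mesh K (e : R) : simplicial_complex K -> 0 < e ->
  exists k, mesh_le (iter_sd k K) e.
Proof.
move=> cK e0; have [D D0 KD] := mesh_ex K.
have q0 : 0 <= n%:R / n.+1%:R :> R by rewrite divr_ge0.
have H k : mesh_le (iter_sd k K) ((n%:R / n.+1%:R) ^+ k * D).
  elim: k => [|k IH]; first by rewrite expr0 mul1r.
  rewrite exprS -mulrA; apply: sd_mesh => //; first exact: iter_sd_complex.
  by rewrite mulr_ge0 ?exprn_ge0.
have : (n%:R / n.+1%:R : R) ^+ k * D @[k --> \oo] --> 0 * D.
  apply: cvgMl; apply: cvg_expr.
  by rewrite ger0_norm // ltr_pdivrMr ?ltr0n // mul1r ltr_nat.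
rewrite mul0r => /cvgrPdist_lt /(_ e e0) [k _ /(_ k (leqnn k))] /=.
rewrite sub0r normrN => /ltW le; exists k => s sK u v us vs.
exact: le_trans (H k s sK u v us vs) (le_trans (ler_norm _) le).
Qed.

Lemma hull_dist s x y (D : R) : (forall v, v \in s -> `|v - y| <= D) ->
  hull s x -> `|x - y| <= D.
Proof.
move=> vD [w [w0 w1 ->]].
have {1}-> : y = \sum_(v <- s) w v *: y by rewrite -scaler_suml w1 scale1r.
rewrite -sumrB; under eq_bigr do rewrite -scalerBr.
apply: le_trans (ler_norm_sum _ _ _) _.
have -> : D = \sum_(v <- s) w v * D by rewrite -mulr_suml w1 mul1r.
rewrite big_seq [leRHS]big_seq.
apply: ler_sum => v vs; rewrite normrZ ger0_norm ?w0 //.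
by rewrite ler_wpM2l ?w0 // vD.
Qed.

Lemma mesh_hull K s x y (D : R) : mesh_le K D -> s \in K -> hull s x -> hull s y ->
  `|x - y| <= D.
Proof.
move=> KD sK sx sy; apply: hull_dist sx => v vs; rewrite distrC.
by apply: hull_dist sy => u us; apply: (KD s).
Qed.

End SubdivisionMetric.

(** * Open stars and Lebesgue numbers *)

Section Topology.
Context {R : realType} {n : nat}.
Local Notation V := 'rV[R]_n.
Implicit Types (s t : {fset V}) (x y : V) (K C : {fset {fset V}}).

Lemma affine_coord_continuous k (A : 'M[R]_(n, k)) (b : 'rV[R]_k) i :
  continuous (fun x : V => (x *m A + b) 0 i).
Proof.
have -> : (fun x : V => (x *m A + b) 0 i) =
    (fun x : V => \sum_j x 0 j * A j i + b 0 i).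
  by apply/funext => x; rewrite !mxE.
have sum_cont r : continuous (fun x : V => \sum_(j <- r) x 0 j * A j i).
  elim: r => [|j r IH] x.
    under eq_fun do rewrite big_nil.
    exact: cst_continuous.
  under eq_fun do rewrite big_cons.
  exact: (continuousD (continuousM (@coord_continuous R 1 n 0 j x)
    (@cst_continuous _ _ (A j i) x)) (IH x)).
by move=> x; exact: (continuousD (sum_cont _ x) (@cst_continuous _ _ (b 0 i) x)).
Qed.

Lemma closed_affine_ge k (A : 'M[R]_(n, k)) (b : 'rV[R]_k) :
  closed [set x : V | forall i, 0 <= (x *m A + b) 0 i].
Proof.
rewrite (_ : [set x | _] = \bigcap_i [set x : V | 0 <= (x *m A + b) 0 i]).
  apply: closed_bigI => i _; apply: (preimage_closed _ (@closed_ge R 0)).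
  by move=> x _; apply: affine_coord_continuous.
by apply/seteqP; split=> x H i; [move=> _; apply: H|apply: H].
Qed.

Lemma closed_affine_eq k (A : 'M[R]_(n, k)) (b : 'rV[R]_k) :
  closed [set x : V | x *m A + b = 0].
Proof.
rewrite (_ : [set x | _] = [set x | forall i, 0 <= (x *m A + b) 0 i] `&`
    [set x | forall i, 0 <= (x *m - A + - b) 0 i]).
  by apply: closedI; apply: closed_affine_ge.
apply/seteqP; split=> x /=.
  by move=> e; rewrite mulmxN -opprD e oppr0; split=> i; rewrite mxE.
move=> [H1 H2]; apply/rowP => i; apply/eqP; rewrite [X in _ == X]mxE eq_le H1 andbT.
by have := H2 i; rewrite mulmxN -opprD [X in _ <= X -> _]mxE oppr_ge0.
Qed.

(** Barycentric coordinates extend to an affine map on the whole space; the hull is cut out by their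
    being nonnegative, summing to 1 ([J]) and reproducing the point ([M]), all closed conditions. *)
Lemma closed_hull s : affinely_independent s -> closed (hull s).
Proof.
move=> ind; pose N := #|` s|.
pose g v : 'rV[R]_N := \row_j (s`_j == v)%:R.
have [A [b Ab]] := affine_extension g ind.
pose M : 'M[R]_(N, n) := \matrix_(j, k) s`_j 0 k.
pose J : 'M[R]_(N, 1) := const_mx 1.
have cE (w : V -> R) : \sum_(v <- s) w v = 1 ->
    (\sum_(v <- s) w v *: v) *m A + b = \row_j w s`_j.
  move=> w1; rewrite affine_sum //; apply/rowP => j; rewrite summxE [RHS]mxE.
  rewrite (big_fsetD1 s`_j) ?mem_nth //= mxE Ab ?mem_nth // mxE eqxx mulr1.
  rewrite big1_fset ?addr0 // => v; rewrite !inE => /andP[vj vs] _.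
  by rewrite mxE Ab // mxE eq_sym (negPf vj) mulr0.
have sumE (F : V -> R) : \sum_(v <- s) F v = \sum_(j < N) F s`_j.
  by rewrite (big_nth 0) big_mkord.
have sumVE (w : V -> R) : (\row_j w s`_j) *m M = \sum_(v <- s) w v *: v.
  apply/rowP => k; rewrite summxE sumE !mxE; apply: eq_bigr => j _.
  by rewrite !mxE.
have sumJE (w : V -> R) : ((\row_j w s`_j) *m J) = const_mx (\sum_(v <- s) w v).
  by apply/rowP => k; rewrite !mxE sumE; apply: eq_bigr => j _; rewrite !mxE mulr1.
rewrite (_ : hull s = [set x | forall i, 0 <= (x *m A + b) 0 i] `&`
  ([set x | x *m (A *m J) + (b *m J - const_mx 1) = 0] `&`
   [set x | x *m (A *m M - 1%:M) + b *m M = 0])).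
  apply: closedI; first exact: closed_affine_ge.
  by apply: closedI; apply: closed_affine_eq.
have e2 x : x *m (A *m J) + (b *m J - const_mx 1) = (x *m A + b) *m J - const_mx 1.
  by rewrite mulmxDl mulmxA addrA.
have e3 x : x *m (A *m M - 1%:M) + b *m M = (x *m A + b) *m M - x.
  by rewrite mulmxBr mulmx1 mulmxDl mulmxA addrAC.
apply/seteqP; split=> x.
  move=> [w [w0 w1 ->]]; split=> /=.
    by move=> i; rewrite cE // mxE w0 ?mem_nth.
  by rewrite e2 e3 cE // sumVE sumJE w1 !subrr.
move=> [/= c0]; rewrite e2 e3 => -[/eqP + /eqP]; rewrite !subr_eq0 => /eqP c1 /eqP cx.
pose w v := if insub (index v s) is Some j then (x *m A + b) 0 j else 0.
have wE (j : 'I_N) : w s`_j = (x *m A + b) 0 j.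
  rewrite /w index_uniq ?fset_uniq // insubT //= => p.
  by congr (_ 0 _); apply/val_inj.
have rE : \row_j w s`_j = x *m A + b by apply/rowP => j; rewrite mxE wE.
exists w; split.
- by move=> v _; rewrite /w; case: insubP.
- have := sumJE w; rewrite rE c1 => /rowP /(_ 0); by rewrite !mxE.
- by rewrite -sumVE rE cx.
Qed.

Lemma compact_hull s : affinely_independent s -> compact (hull s).
Proof.
move=> ind; apply: bounded_closed_compact; last exact: closed_hull.
pose D := \sum_(v <- s) `|v|.
exists D; split; first by rewrite num_real.
move=> e De x sx; rewrite /= -[x]subr0; apply: le_trans (ltW De).
apply: hull_dist sx => v vs; rewrite subr0 /D (big_fsetD1 v vs) /= lerDl.
by apply: sumr_ge0.
Qed.

Lemma closed_hulls K (P : {fset V} -> bool) : simplicial_complex K ->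
  closed (\bigcup_(s in [set s | s \in K /\ P s]) hull s).
Proof.
move=> [ind _ _]; apply: closed_bigcup.
  by apply: sub_finite_set (finite_fset K) => s [].
by move=> s [sK _]; apply: closed_hull; have [] := ind s sK.
Qed.

Lemma compact_polyhedron K : simplicial_complex K -> compact (polyhedron K).
Proof.
move=> [ind _ _].
have -> : polyhedron K = \big[setU/set0]_(s <- K) hull s.
  rewrite -bigcup_seq; apply/seteqP; split=> x [s sK sx]; exists s => //.
rewrite big_seq; apply: bigsetU_compact => s sK.
by apply: compact_hull; have [] := ind s sK.
Qed.

(** For a single vertex this is its open star, for a maximal simplex its relative interior. *)
Definition open_star K u : set V :=
  [set y | exists t, [/\ t \in K, (u `<=` t)%fset & ohull t y]].

(** Within the polyhedron, the complement of the star is covered by the closed simplices that do not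
    contain [u], and these avoid the star. *)
Lemma open_star_nbhs K u y : simplicial_complex K -> open_star K u y ->
  \forall y' \near y, polyhedron K y' -> open_star K u y'.
Proof.
move=> cK [t [tK ut ty]].
pose Z := \bigcup_(s in [set s | s \in K /\ ~~ (u `<=` s)%fset]) hull s.
have cZ : closed Z by apply: closed_hulls.
have : nbhs y (~` Z).
  apply: open_nbhs_nbhs; split; first exact: closed_openC.
  move=> [s [sK us] sy]; move/negP: us; apply.
  exact: fsubset_trans ut (carrier_sub cK tK sK ty sy).
apply: filterS => y' Zy' [s sK sy'].
have [s' [s'K _ s'y]] := carrier_ex cK sK sy'.
exists s'; split=> //; apply: contraT => us'; case: Zy'.
by exists s' => //; apply: ohull_hull.
Qed.

End Topology.

Section Lebesgue.
Context {R : realType} {n m : nat}.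
Context (K : {fset {fset 'rV[R]_n}}) (L : {fset {fset 'rV[R]_m}}).
Context (cK : simplicial_complex K) (cL : simplicial_complex L).
Context (f : 'rV[R]_n -> 'rV[R]_m).
Context (f_fun : set_fun (polyhedron K) (polyhedron L) f).
Context (f_cont : {within polyhedron K, continuous f}).

Lemma open_star_preimage u x : polyhedron K x -> open_star L u (f x) ->
  exists2 r : R, 0 < r & forall x', polyhedron K x' -> `|x - x'| < r -> open_star L u (f x').
Proof.
move=> Kx /(open_star_nbhs cL) Ow.
have /subspace_continuousP /(_ x Kx _ Ow) := f_cont.
rewrite /= nbhs_simpl /= => /nbhs_normP[r /= r0 H]; exists r => // x' Kx' xx'.
by apply: (H x' xx' Kx'); apply: f_fun.
Qed.

(** A Lebesgue number for the cover of |K| by the preimages of open vertex stars. Compactness is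
    used in its near-covering form: what holds locally for all small [d] holds everywhere for one
    [d]. *)
Lemma open_star_lebesgue : exists2 d : R, 0 < d &
  forall x, polyhedron K x -> exists w, forall x', polyhedron K x' ->
    `|x - x'| < d -> open_star L [fset w]%fset (f x').
Proof.
pose P d x := exists w, forall x', polyhedron K x' -> `|x - x'| < d -> open_star L [fset w]%fset (f x').
have cov x : polyhedron K x -> \forall x' \near x & d \near (0 : R)^'+, P d x'.
  move=> Kx; have [t tL tfx] := f_fun Kx.
  have [u [uL _ ufx]] := carrier_ex cL tL tfx.
  have [ind _ _] := cL; have /fset0Pn[w wu] : u != fset0 by have [] := ind u uL.
  have wfx : open_star L [fset w]%fset (f x) by exists u; rewrite fsub1set.
  have [r r0 Hr] := open_star_preimage Kx wfx.
  (* One half of the radius is for moving the centre, the other half is left to [d]. *)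
  have r20 : 0 < r / 2 by rewrite divr_gt0.
  exists (ball x (r / 2), [set d | d < r / 2]) => /=.
    split; first exact: nbhsx_ballx.
    exact: nbhs_right_lt.
  move=> [x' d] /= [xx' dr]; exists w => y Ky x'y; apply: Hr => //.
  rewrite -ball_normE /= in xx'.
  apply: le_lt_trans (ler_distD x' x y) _; rewrite (splitr r).
  by apply: ltrD => //; apply: lt_trans dr.
have /compact_near_coveringP cov_cpt := compact_polyhedron cK.
have cov_near := cov_cpt R (0^'+) P _ cov.
near (0 : R)^'+ => d.
have KP : polyhedron K `<=` P d by near: d; apply: cov_near.
have d0 : 0 < d by near: d; apply: nbhs_right_gt.
by exists d => // x /KP.
Unshelve. all: by end_near.
Qed.

End Lebesgue.

(** * Definable surjections onto a simplex *)

Section SimplexCharts.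
Context {R : realType} {n : nat}.
Local Notation V := 'rV[R]_n.
Implicit Types (s t : {fset V}) (x y : V).

(* Affine chart of the span of s, with the first vertex as origin; the rows
   beyond the last vertex vanish. *)
Definition origin s : V := head 0 s.
Definition edges s d : 'M[R]_(d, n) :=
  \matrix_(i, k) (nth (origin s) s i.+1 - origin s) 0 k.

Lemma mul_edges s d (a : 'rV[R]_d) :
  a *m edges s d = \sum_i a 0 i *: (nth (origin s) s i.+1 - origin s).
Proof.
rewrite mulmx_sum_row; apply: eq_bigr => i _; congr (_ *: _).
by apply/rowP => k; rewrite !mxE.
Qed.

Lemma nth0_origin s : nth (origin s) s 0 = origin s.
Proof. by rewrite /origin; case: (enum_fset s). Qed.

Lemma hull_chart s d x : (#|` s| <= d.+1)%N -> hull s x ->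
  exists a : 'rV[R]_d, x = a *m edges s d + origin s.
Proof.
move=> sd [w [w0 w1 ->]]; set o := origin s.
exists (\row_i (if (i.+1 < #|` s|)%N then w (nth o s i.+1) else 0)).
have s0 : (0 < #|` s|)%N.
  rewrite cardfs_gt0; apply/eqP => s0; move/eqP: w1.
  by rewrite s0 big_seq_fset0 eq_sym oner_eq0.
have -> : \sum_(v <- s) w v *: v = \sum_(v <- s) w v *: (v - o) + o.
  under [in RHS]eq_bigr do rewrite scalerBr.
  by rewrite sumrB -scaler_suml w1 scale1r subrK.
congr (_ + _); rewrite mul_edges -/o (big_nth o) big_mkord.
have -> : \sum_(i < #|` s|) w (nth o s i) *: (nth o s i - o) =
    \sum_(i < d.+1) (if (i < #|` s|)%N then w (nth o s i) else 0) *: (nth o s i - o).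
  rewrite (big_ord_widen d.+1 (fun i => w (nth o s i) *: (nth o s i - o)) sd) big_mkcond.
  by apply: eq_bigr => i _; case: ifP => //; rewrite scale0r.
rewrite big_ord_recl s0 /= nth0_origin subrr scaler0 add0r.
by apply: eq_bigr => i _; rewrite mxE.
Qed.

(** Barycentric coordinates from chart coordinates; the first vertex receives what is missing to
    1. *)
Definition chart_weight s d (a : 'rV[R]_d) (v : V) : R :=
  if index v s is j.+1 then (if insub j is Some i then a 0 i else 0) else 1 - \sum_i a 0 i.

Lemma chart_weightS s d (a : 'rV[R]_d) (i : 'I_d) : #|` s| = d.+1 ->
  chart_weight s a (nth (origin s) s i.+1) = a 0 i.
Proof.
move=> sd; rewrite /chart_weight index_uniq ?fset_uniq ?sd ?ltnS //.
by rewrite insubT //= => p; congr (a 0 _); apply/val_inj.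
Qed.

Lemma chart_weight0 s d (a : 'rV[R]_d) : #|` s| = d.+1 ->
  chart_weight s a (nth (origin s) s 0) = 1 - \sum_i a 0 i.
Proof. by move=> sd; rewrite /chart_weight index_uniq ?fset_uniq ?sd. Qed.

Lemma sum_chart (M : nmodType) s d (F : V -> M) : #|` s| = d.+1 ->
  \sum_(v <- s) F v = F (nth (origin s) s 0) + \sum_(i < d) F (nth (origin s) s i.+1).
Proof.
move=> sd; rewrite (big_nth (origin s)) big_mkord.
by rewrite -[size _]/(#|` s|) sd big_ord_recl.
Qed.

Lemma chart_weight_sum s d (a : 'rV[R]_d) : #|` s| = d.+1 ->
  \sum_(v <- s) chart_weight s a v = 1.
Proof.
move=> sd; rewrite (sum_chart (chart_weight s a) sd) chart_weight0 //.
by under [X in _ + X]eq_bigr => i _ do rewrite (chart_weightS a i sd); rewrite subrK.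
Qed.

Lemma chart_weight_bary s d (a : 'rV[R]_d) : #|` s| = d.+1 ->
  \sum_(v <- s) chart_weight s a v *: v = a *m edges s d + origin s.
Proof.
move=> sd; rewrite (sum_chart _ sd) /= chart_weight0 // mul_edges.
under [X in _ + X]eq_bigr => i _ do rewrite (chart_weightS a i sd).
under [in RHS]eq_bigr do rewrite scalerBr.
rewrite sumrB -scaler_suml nth0_origin scalerBl scale1r.
by rewrite addrAC -addrA addrC.
Qed.

Lemma chart_inj s d (a b : 'rV[R]_d) : affinely_independent s -> #|` s| = d.+1 ->
  a *m edges s d + origin s = b *m edges s d + origin s -> a = b.
Proof.
move=> ind sd; rewrite -!chart_weight_bary // => e; apply/rowP => i.
rewrite -(chart_weightS a i sd) -(chart_weightS b i sd).
apply: (affinely_independent_inj ind) e _ _; first by rewrite !chart_weight_sum.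
by rewrite mem_nth // sd ltnS.
Qed.

(** The [d] coordinates sum to at most d/(d+1), which leaves a positive weight for the first vertex.
    This supplies the open box for [finite_fibers_dim]. *)
Lemma chart_ohull s d (a : 'rV[R]_d) : #|` s| = d.+1 ->
  (forall i, 0 < a 0 i < d.+1%:R^-1) -> ohull s (a *m edges s d + origin s).
Proof.
move=> sd ai; exists (chart_weight s a); rewrite chart_weight_sum // chart_weight_bary //.
split=> // v vs; rewrite -(nth_index (origin s) vs).
have : (index v s < d.+1)%N by rewrite -sd index_mem.
case: (index v s) => [_|j]; last first.
  by rewrite ltnS => jd; rewrite (chart_weightS a (Ordinal jd) sd); case/andP: (ai (Ordinal jd)).
rewrite chart_weight0 // subr_gt0.
apply: (@le_lt_trans _ _ (\sum_(i < d) d.+1%:R^-1)).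
  by apply: ler_sum => i _; case/andP: (ai i) => _ /ltW.
rewrite sumr_const card_ord -[X in X < _]mulr_natl ltr_pdivrMr ?ltr0n //.
by rewrite mul1r ltr_nat.
Qed.

End SimplexCharts.

(** Otherwise every simplex meeting the preimage of the interior of [t] has smaller dimension, and
    R^e parametrizes them all. In charts the graph of [f] then covers an open box of R^(e+1) with
    finite fibres, against [finite_fibers_dim]. *)
Lemma surjection_dim (R : realType) (S : o_minimal_structure R) n m
    (K : {fset {fset 'rV[R]_n}}) (f : 'rV[R]_n -> 'rV[R]_m) (t : {fset 'rV[R]_m}) :
  definable_map S (polyhedron K) f -> affinely_independent t -> t != fset0 ->
  (forall y, ohull t y -> exists2 x, polyhedron K x & f x = y) ->
  exists s x, [/\ s \in K, hull s x, ohull t (f x) & (#|` t| <= #|` s|)%N].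
Proof.
move=> f_def ind t0 surj.
have [d td] : exists d, #|` t| = d.+1.
  by move: t0; rewrite -cardfs_gt0; case: #|` t| => // d _; exists d.
apply: contrapT => nex.
have small s x : s \in K -> hull s x -> ohull t (f x) -> (#|` s| <= d)%N.
  move=> sK sx tfx; rewrite leqNgt; apply/negP => ds; apply: nex.
  by exists s, x; split=> //; rewrite td.
have [x0 [s0 s0K s0x] fx0] := surj _ (barycenter_ohull t0).
(* The barycenter of [t] has a preimage in some simplex, which has a vertex; so [d] can be written
   [e.+1]. *)
have d0 : (0 < d)%N.
  have : (0 < #|` s0|)%N.
    rewrite cardfs_gt0; apply/eqP => e; have [w [_ /eqP + _]] := s0x.
    by rewrite e big_seq_fset0 eq_sym oner_eq0.
  move/leq_trans; apply; apply: (small s0 x0) => //.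
  by rewrite fx0; apply: barycenter_ohull.
case: d d0 td small => // e _ td small.
have m0 : (0 < m)%N by have := card_affinely_independent ind; rewrite td ltnS; apply: leq_trans.
pose G := [set z : 'rV[R]_(n + m) | polyhedron K (lsubmx z) /\ rsubmx z = f (lsubmx z)].
pose A s : 'M[R]_(e + e.+1, n + m) := block_mx (edges s e) 0 0 (edges t e.+1).
pose Gam s := [set z : 'rV[R]_(e + e.+1) | G (z *m A s + row_mx (origin s) (origin t))].
pose X := [set z | exists2 s, s \in K & Gam s z].
have dX : definable S X.
  apply: definable_bigcup => [|s sK]; first by rewrite addnS.
  apply: definable_affine_preimage => //; first by rewrite addn_gt0 m0 orbT.
  by rewrite addnS.
have GamE s a b : Gam s (row_mx a b) <-> polyhedron K (a *m edges s e + origin s) /\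
    b *m edges t e.+1 + origin t = f (a *m edges s e + origin s).
  rewrite /Gam /G /= mul_row_block !mulmx0 addr0 add0r add_row_mx.
  by rewrite row_mxKl row_mxKr.
have c0 : 0 < e.+2%:R^-1 :> R by rewrite invr_gt0 ltr0n.
have [//|b bpos|a iX] := finite_fibers_dim _ dX c0.
  have tb := chart_ohull td bpos; have [x [s sK sx] fx] := surj _ tb.
  have se : (#|` s| <= e.+1)%N by apply: (small s x); rewrite ?fx.
  have [a xa] := hull_chart se sx; exists a, s => //; apply/GamE.
  by rewrite -xa; split=> //; exists s.
(* For fixed [a], each of the finitely many simplices of [K] gives at most one value [b]. *)
apply: iX; apply: (@sub_finite_set _ _ (\bigcup_(s in [set` K]) [set b | Gam s (row_mx a b)])).
  by move=> b [s sK Gs]; exists s.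
apply: bigcup_finite => [|s _]; first exact: finite_fset.
have [[b Gb]|nb] := pselect (exists b, Gam s (row_mx a b)).
  apply: sub_finite_set (finite_set1 b) => c /= /GamE[_ fc].
  have [_ fb] := (GamE s a b).1 Gb.
  by apply: (chart_inj ind td); rewrite fc.
rewrite (_ : [set b | _] = set0) //; apply/seteqP; split=> // b Gb.
by apply: nb; exists b.
Qed.

(** * Surjective simplicial approximation *)

Lemma finite_pos_min (R : realDomainType) (T : eqType) (r : seq T) (P : T -> R -> Prop) :
  (forall t d d', d' <= d -> P t d -> P t d') ->
  (forall t, t \in r -> exists2 d, 0 < d & P t d) ->
  exists2 d, 0 < d & forall t, t \in r -> P t d.
Proof.
move=> mono; elim: r => [|t r IH] H; first by exists 1.
have [d d0 Hd] : exists2 d, 0 < d & forall t, t \in r -> P t d.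
  by apply: IH => u ur; apply: H; rewrite in_cons ur orbT.
have [e e0 He] := H t (mem_head _ _).
exists (Num.min d e) => [|u]; first by rewrite lt_min d0.
rewrite in_cons => /predU1P[->|ur]; first by apply: mono He; rewrite ge_min lexx orbT.
by apply: mono (Hd u ur); rewrite ge_min lexx.
Qed.

(** Elements are matched by their positions in the enumerations, and surplus elements of [s] go to a
    fixed [w0]. *)
Lemma fset_surjection (T T' : choiceType) (s : {fset T}) (t : {fset T'}) :
  t != fset0 -> (#|` t| <= #|` s|)%N ->
  exists g : T -> T', (forall v, v \in s -> g v \in t) /\
    forall w, w \in t -> exists2 v, v \in s & g v = w.
Proof.
move=> t0 ts; have /fset0Pn[w0 w0t] := t0.
have /fset0Pn[v0 v0s] : s != fset0.
  by rewrite -cardfs_gt0 (leq_trans _ ts) // cardfs_gt0.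
exists (fun v => nth w0 t (index v s)); split.
  move=> v vs; have [it|ti] := ltnP (index v s) (size t); first exact: mem_nth.
  by rewrite nth_default.
move=> w wt; have it : (index w t < size s)%N.
  by apply: leq_trans ts; rewrite index_mem.
exists (nth v0 s (index w t)); first exact: mem_nth.
by rewrite index_uniq ?fset_uniq // nth_index.
Qed.

(** The factor [m.+1] exceeds the square root of [m] and can be divided by even when [m] is 0. *)
Lemma enorm_le (R : realType) m (x : 'rV[R]_m) : enorm x <= m.+1%:R * `|x|.
Proof.
have m0 : 0 <= m.+1%:R * `|x| by rewrite mulr_ge0.
rewrite -(ger0_norm m0) -sqrtr_sqr ler_sqrt ?sqr_ge0 //.
apply: (@le_trans _ _ (\sum_(i < m) `|x| ^+ 2)).
  apply: ler_sum => i _; rewrite -real_normK ?num_real // lerXn2r ?nnegrE //.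
  have -> : `|x| = \big[Num.max/0]_ij `|x ij.1 ij.2| := mx_normrE x.
  exact: (le_bigmax 0 (fun ij : 'I_1 * 'I_m => `|x ij.1 ij.2|) (0, i)).
rewrite sumr_const card_ord exprMn -[leLHS]mulr_natl ler_wpM2r ?sqr_ge0 //.
by rewrite -natrX ler_nat; nia.
Qed.

Section Maximal.
Context {R : realType} {m : nat}.
Context (L : {fset {fset 'rV[R]_m}}).

Definition maximal t := t \in L /\ forall u, u \in L -> (t `<=` u)%fset -> u = t.

Lemma maximal_ex t : t \in L -> exists2 u, maximal u & (t `<=` u)%fset.
Proof.
move=> tL; pose D := [fset u in L | (t `<=` u)%fset]%fset.
have D0 : D != fset0 by apply/fset0Pn; exists t; rewrite !inE tL fsubset_refl.
have [u uD umax] := seq_argmax (fun s : {fset 'rV[R]_m} => #|` s|) (fset_seq_neq0 D0).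
have /andP[uL tu] : (u \in L) && (t `<=` u)%fset by move: uD; rewrite !inE.
exists u => //; split=> // u' u'L uu'; apply/eqP; rewrite eq_sym eqEfcard uu' umax //.
by rewrite !inE u'L (fsubset_trans tu).
Qed.

Lemma open_star_maximal t y : maximal t -> open_star L t y -> ohull t y.
Proof. by move=> [tL tmax] [u [uL tu uy]]; rewrite -(tmax u uL tu). Qed.

End Maximal.

(** * Simplicial maps induced by vertex labels *)

Section SimplicialExtension.
Context {R : realType} {n m : nat}.
Context (K : {fset {fset 'rV[R]_n}}) (L : {fset {fset 'rV[R]_m}}).
Context (cK : simplicial_complex K).
Context (phi : 'rV[R]_n -> 'rV[R]_m).

(** The value is computed in the carrier of the point. Any other simplex containing the point
    contains the carrier, and its further weights vanish. *)
Lemma simplicial_extension : exists h : 'rV[R]_n -> 'rV[R]_m,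
  forall s (w : 'rV[R]_n -> R), s \in K -> (forall v, v \in s -> 0 <= w v) ->
    \sum_(v <- s) w v = 1 ->
    h (\sum_(v <- s) w v *: v) = \sum_(v <- s) w v *: phi v.
Proof.
suff /choice[h hP] : forall x, exists y, forall s (w : 'rV[R]_n -> R), s \in K ->
    (forall v, v \in s -> 0 <= w v) -> \sum_(v <- s) w v = 1 ->
    x = \sum_(v <- s) w v *: v -> y = \sum_(v <- s) w v *: phi v.
  by exists h => s w sK w0 w1; apply: hP.
move=> x; have [[s0 s0K s0x]|nx] := pselect (polyhedron K x); last first.
  by exists 0 => s w sK w0 w1 xE; case: nx; exists s => //; exists w.
have [t [tK _ tx]] := carrier_ex cK s0K s0x; have [u [u0 u1 xu]] := tx.
exists (\sum_(v <- t) u v *: phi v) => s w sK w0 w1 xw.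
have sx : hull s x by exists w.
have ts := carrier_sub cK tK sK tx sx.
have [ind _ _] := cK.
rewrite -(sum_extend _ ts); apply: eq_big_seq => v vs.
rewrite -(affinely_independent_inj (w' := w) (w := fun v => if v \in t then u v else 0) (ind s sK).2 _ _ vs).
- by case: ifP => //; rewrite scale0r.
- by rewrite sum_extend // w1.
- rewrite -xw xu -(sum_extend _ ts); apply: eq_bigr => y _.
  by case: ifP => //; rewrite scale0r.
Qed.

Context (h : 'rV[R]_n -> 'rV[R]_m).
Context (hP : forall s (w : 'rV[R]_n -> R), s \in K -> (forall v, v \in s -> 0 <= w v) ->
    \sum_(v <- s) w v = 1 ->
    h (\sum_(v <- s) w v *: v) = \sum_(v <- s) w v *: phi v).

Lemma extension_vertex s v : s \in K -> v \in s -> h v = phi v.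
Proof.
move=> sK vs; have [_ face _] := cK.
have vK : [fset v]%fset \in K.
  by apply: (face s) => //; [apply/fset0Pn; exists v; rewrite inE|rewrite fsub1set].
have := hP vK (w := fun=> 1) (fun _ _ => ler01).
by rewrite !big_seq_fset1 !scale1r; apply.
Qed.

Lemma extension_hull s x t : s \in K -> hull s x ->
  (forall v, v \in s -> phi v \in t) -> hull t (h x).
Proof.
move=> sK [w [w0 w1 ->]] st; rewrite hP //.
by apply: hull_conv => // v /st; apply: hull_vertex.
Qed.

Lemma extension_simplicial : (forall s, s \in K -> [fset phi v | v in s]%fset \in L) ->
  simplicial_map K L h.
Proof.
move=> phiL; have [ind _ _] := cK; split.
- move=> x [s sK sx]; exists [fset phi v | v in s]%fset; first exact: phiL.
  by apply: (extension_hull sK sx) => v vs; apply/imfsetP; exists v.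
- move=> s sK; have [A [b Ab]] := affine_extension phi (ind s sK).2.
  exists A, b => _ [w [w0 w1 ->]]; rewrite hP // affine_sum //.
  by apply: eq_big_seq => v vs; rewrite Ab.
- move=> s sK; have -> : [fset h v | v in s]%fset = [fset phi v | v in s]%fset.
    by apply: eq_in_imfset => // v vs; apply: extension_vertex vs.
  exact: phiL.
Qed.

(** Choosing one preimage [j w] for each vertex [w] of a maximal [t] gives a face of [s] that [h]
    maps affinely onto [t]. *)
Lemma extension_surj : simplicial_complex L ->
  (forall t, maximal L t -> exists2 s, s \in K &
    (forall w, w \in t -> exists2 v, v \in s & phi v = w)) ->
  set_surj (polyhedron K) (polyhedron L) h.
Proof.
move=> cL surj y [t0 t0L t0y]; have [t tmax tt0] := maximal_ex t0L.
have [mu [mu0 mu1 ->]] := hull_sub tt0 t0y.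
have [s sK st] := surj t tmax; have [_ face _] := cK; have [ind _ _] := cL.
have [j jP] : {j : 'rV[R]_m -> 'rV[R]_n & forall w, w \in t -> j w \in s /\ phi (j w) = w}.
  apply: (@choice _ _ (fun w v => w \in t -> v \in s /\ phi v = w)) => w.
  by have [/st[v vs vw]|//] := boolP (w \in t); [exists v|exists 0].
pose u := [fset j w | w in t]%fset.
have j_inj : {in t &, injective j}.
  by move=> a b /jP[_ ea] /jP[_ eb] e; rewrite -ea -eb e.
have us : (u `<=` s)%fset by apply/fsubsetP => _ /imfsetP[w /= /jP[js _] ->].
have uK : u \in K.
  apply: (face s) => //; have /fset0Pn[w wt] : t != fset0 by have [] := ind t tmax.1.
  by apply/fset0Pn; exists (j w); apply/imfsetP; exists w.
have mu0' v : v \in u -> 0 <= mu (phi v).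
  by move=> /imfsetP[w /= wt ->]; rewrite (jP w wt).2 mu0.
have sumE (M : nmodType) (F : 'rV[R]_n -> M) :
    \sum_(v <- u) F v = \sum_(w <- t) F (j w) by rewrite big_imfset.
have mu1' : \sum_(v <- u) mu (phi v) = 1.
  by rewrite sumE -mu1; apply: eq_big_seq => w /jP[_ ->].
exists (\sum_(v <- u) mu (phi v) *: v).
  by exists u => //; exists (fun v => mu (phi v)).
rewrite (hP (w := fun v => mu (phi v))) // sumE.
by apply: eq_big_seq => w /jP[_ ->].
Qed.

End SimplicialExtension.

Lemma fun_norm_lt (R : realType) n m (X : set 'rV[R]_n) (g : 'rV[R]_n -> 'rV[R]_m)
    (d e : R) : 0 <= d -> d < e -> (forall x, X x -> enorm (g x) <= d) ->
  fun_norm X g < e.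
Proof.
move=> d0 de gd; rewrite /fun_norm.
have [[x Xx]|nX] := pselect (exists x, X x); last first.
  (* On an empty set the supremum is 0, which is where [0 <= d] enters. *)
  rewrite (_ : [set _ | _ in X] = set0) ?sup0; first exact: le_lt_trans de.
  by apply/seteqP; split=> // y [x Xx _]; apply: nX; exists x.
apply: le_lt_trans de; apply: ge_sup; first by exists (enorm (g x)), x.
by move=> _ [y Xy <-]; apply: gd.
Qed.

Theorem proposition1p5 (R : realType) (S : o_minimal_structure R) (n m : nat)
    (K : {fset {fset 'rV[R]_n}}) (L : {fset {fset 'rV[R]_m}})
    (hK : simplicial_complex K) (hL : simplicial_complex L)
    (f : 'rV[R]_n -> 'rV[R]_m)
    (f_fun : set_fun (polyhedron K) (polyhedron L) f)
    (f_surj : set_surj (polyhedron K) (polyhedron L) f)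
    (f_cont : {within polyhedron K, continuous f})
    (f_def : definable_map S (polyhedron K) f)
    (eps : R) (eps_gt0 : 0 < eps) :
  exists (kappa l : nat) (h : 'rV[R]_n -> 'rV[R]_m),
    [/\ simplicial_map (iter_sd kappa K) (iter_sd l L) h,
        set_surj (polyhedron (iter_sd kappa K)) (polyhedron (iter_sd l L)) h &
        fun_norm (polyhedron K) (fun x => f x - h x) < eps].
Proof.
(* Halving leaves room for the strict inequality; the divisor [m.+1] pays for passing from the sup
   norm to the Euclidean norm. *)
pose D := eps / 2 / m.+1%:R.
have D0 : 0 < D by rewrite !divr_gt0.
have [l L'D] := iter_sd_mesh hL D0.
have hL' := iter_sd_complex l hL; have L'E := polyhedron_iter_sd l hL.
set L' := iter_sd l L in L'D hL' L'E.
rewrite -L'E in f_fun f_surj.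
have [indL' faceL' _] := hL'.
have [d1 d10 leb] := open_star_lebesgue hK hL' f_fun f_cont.
(* For a maximal [t]: a point [x] of a simplex of [K] with at least as many vertices as [t], such
   that [f] stays in the interior of [t] at distance less than [d] from [x]. *)
pose P t (d : R) := maximal L' t -> exists s x, [/\ s \in K, hull s x,
  (#|` t| <= #|` s|)%N & forall x', polyhedron K x' -> `|x - x'| < d -> open_star L' t (f x')].
have [d2 d20 Pd2] : exists2 d, 0 < d & forall t, t \in enum_fset L' -> P t d.
  apply: finite_pos_min.
    move=> t d d' dd' Pd tmax; have [s [x [sK sx ts H]]] := Pd tmax.
    by exists s, x; split=> // x' Kx' xx'; apply: H => //; apply: lt_le_trans dd'.
  move=> t tL'; have [t0 indt] := indL' t tL'.
  have [y ty|s [x [sK sx tfx ts]]] := surjection_dim f_def indt t0.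
    by have [|x Kx <-] := f_surj y; [exists t => //; apply: ohull_hull|exists x].
  have Kx : polyhedron K x by exists s.
  have tfx' : open_star L' t (f x) by exists t.
  have [r r0 Hr] := open_star_preimage hL' f_fun f_cont Kx tfx'.
  by exists r => // _; exists s, x.
pose d := Num.min d1 d2; have d0 : 0 < d by rewrite lt_min d10.
(* With mesh d/3, closed vertex stars lie in balls of radius d/2, and d/3 + d/2 is still below d. *)
have [k K'd] := iter_sd_mesh hK (divr_gt0 d0 (ltr0n R 3)).
have hK' := iter_sd_complex k hK; have K'E := polyhedron_iter_sd k hK.
have flag := iter_sd_flag k hK.
set K' := iter_sd k K in K'd hK' K'E flag.
have [indK' faceK' _] := hK'.
pose good v u := forall x, polyhedron K x -> `|v - x| < d / 2 -> open_star L' u (f x).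
have [sg sgP] : {sg : {fset 'rV[R]_m} -> {fset 'rV[R]_n} * ('rV[R]_n -> 'rV[R]_m) &
    forall t, maximal L' t -> [/\ (sg t).1 \in K', forall v, v \in (sg t).1 -> good v t,
     forall v, v \in (sg t).1 -> (sg t).2 v \in t &
     forall w, w \in t -> exists2 v, v \in (sg t).1 & (sg t).2 v = w]}.
  apply: (@choice _ _ (fun t sg => maximal L' t -> [/\ sg.1 \in K',
     forall v, v \in sg.1 -> good v t, forall v, v \in sg.1 -> sg.2 v \in t &
     forall w, w \in t -> exists2 v, v \in sg.1 & sg.2 v = w])) => t.
  have [tmax|] := pselect (maximal L' t); last by exists (fset0, fun=> 0).
  have [s [x [sK sx ts H]]] := Pd2 t tmax.1 tmax.
  have [s' [s'K' s'x s's]] := flag s x sK sx.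
  have [t0 _] := indL' t tmax.1.
  rewrite -s's in ts; have [g [g1 g2]] := fset_surjection t0 ts.
  exists (s', g) => _; split=> // v vs' y Ky vy; apply: H => //.
  have xv : `|x - v| <= d / 3 by apply: (mesh_hull K'd s'K' s'x); apply: hull_vertex.
  have dd2 : d <= d2 by rewrite ge_min lexx orbT.
  apply: le_lt_trans (ler_distD v x y) _; lra.
have vK' s v : s \in K' -> v \in s -> polyhedron K v.
  by move=> sK' vs; rewrite -K'E; exists s => //; apply: hull_vertex.
(* Vertices of the chosen simplices get the labels prescribed by [sg], the other vertices a label
   from the Lebesgue number. *)
have [phi phiP] : {phi : 'rV[R]_n -> 'rV[R]_m & forall v,
    (polyhedron K v -> good v [fset phi v]%fset) /\
    forall t, maximal L' t -> v \in (sg t).1 -> phi v = (sg t).2 v}.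
  apply: (@choice _ _ (fun v w => (polyhedron K v -> good v [fset w]%fset) /\
    forall t, maximal L' t -> v \in (sg t).1 -> w = (sg t).2 v)) => v.
  have [[t [tmax vt]]|nt] := pselect (exists t, maximal L' t /\ v \in (sg t).1).
    have [sK' gd gt _] := sgP t tmax.
    exists ((sg t).2 v); split.
      move=> Kv x Kx vx; have [u [uL' tu ux]] := gd v vt x Kx vx.
      by exists u; split=> //; rewrite fsub1set (fsubsetP tu) ?gt.
    (* A vertex shared by two chosen simplices is sent by [f] into the interiors of both [t] and
       [t'], so these coincide and the labels agree. *)
    move=> t' t'max vt'; have [_ gd' _ _] := sgP t' t'max.
    have Kv := vK' _ _ sK' vt.
    have vv : `|v - v| < d / 2 by rewrite subrr normr0 divr_gt0.
    have tv := open_star_maximal tmax (gd v vt v Kv vv).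
    have t'v := open_star_maximal t'max (gd' v vt' v Kv vv).
    by rewrite (carrier_uniq hL' tmax.1 t'max.1 tv t'v).
  have [Kv|nKv] := pselect (polyhedron K v).
    have [w Hw] := leb v Kv; exists w; split; last by move=> t tmax vt; case: nt; exists t.
    move=> _ x Kx vx; apply: Hw => //; apply: lt_trans vx _.
    have dd1 : d <= d1 by rewrite ge_min lexx.
    lra.
  by exists 0; split=> // t tmax vt; case: nt; exists t.
(* The image of [x] lies in the open star of each label, so every label is a vertex of its carrier
   [t]. *)
have car s x t : s \in K' -> hull s x -> t \in L' -> ohull t (f x) ->
    forall v, v \in s -> phi v \in t.
  move=> sK' sx tL' tfx v vs; have [+ _] := phiP v.
  move=> /(_ (vK' s v sK' vs) x) [||u [uL' pu ufx]].
  - by rewrite -K'E; exists s.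
  - have : `|v - x| <= d / 3 by apply: (mesh_hull K'd sK' _ sx); apply: hull_vertex.
    by move/le_lt_trans; apply; lra.
  - by rewrite (carrier_uniq hL' tL' uL' tfx ufx) -fsub1set.
have fcar s x : s \in K' -> hull s x -> exists2 t, t \in L' & ohull t (f x).
  move=> sK' sx; have [t tL' tfx] : polyhedron L' (f x).
    by apply: f_fun; rewrite -K'E; exists s.
  by have [u [uL' _ ufx]] := carrier_ex hL' tL' tfx; exists u.
have phiL s : s \in K' -> [fset phi v | v in s]%fset \in L'.
  move=> sK'; have [s0 _] := indK' s sK'.
  have sb := ohull_hull (barycenter_ohull s0).
  (* Any point of the simplex would do here: the carrier of its image contains all the labels, which
     thus span a face of it. *)
  have [t tL' tf] := fcar s _ sK' sb; apply: (faceL' t) => //.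
    by have /fset0Pn[v vs] := s0; apply/fset0Pn; exists (phi v); apply/imfsetP; exists v.
  by apply/fsubsetP => _ /imfsetP[v /= vs ->]; apply: car tf v vs.
have [h hP] := simplicial_extension hK' phi.
exists k, l, h; split.
- exact: (extension_simplicial hK' hP phiL).
- apply: (extension_surj hK' hP hL') => t tmax.
  have [sK' _ _ gs] := sgP t tmax; exists (sg t).1 => // w /gs[v vs vw].
  by exists v => //; rewrite (proj2 (phiP v) t tmax vs).
- apply: (@fun_norm_lt _ _ _ _ _ (eps / 2)); [exact/ltW/divr_gt0|lra|].
  move=> x; rewrite -K'E => -[s sK' sx].
  have [t tL' tf] := fcar s x sK' sx.
  (* Both [f x] and [h x] lie in the simplex [t] of [L'], whose diameter is at most [D]. *)
  have th := extension_hull hP sK' sx (car s x t sK' sx tL' tf).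
  have := mesh_hull L'D tL' (ohull_hull tf) th.
  move=> le; apply: le_trans (enorm_le _) _.
  by rewrite mulrC -ler_pdivlMr ?ltr0n.
Qed.
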